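(* Let $\mathfrak{L}=\bigoplus_{n\in\mathbb{Z}}\mathfrak{L}_n$ be a graded Lie algebra over a field $\mathfrak{k}$, with $\mathfrak{L}_0\neq\{0\}$, which has a non-degenerate symmetric invariant bilinear form $B_{\mathfrak{L}}$. Suppose that: (1) $\mathfrak{L}_{i+1}=[\mathfrak{L}_1,\mathfrak{L}_i]$ and $\mathfrak{L}_{-i-1}=[\mathfrak{L}_{-1},\mathfrak{L}_{-i}]$ for all $i\ge1$; (2) the restriction of $B_{\mathfrak{L}}$ to $\mathfrak{L}_i\times\mathfrak{L}_{-i}$ is non-degenerate for any $i\ge0$. Then the pentad $(\mathfrak{L}_0,\mathrm{ad},\mathfrak{L}_1,\mathfrak{L}_{-1},B_{\mathfrak{L}}|_{\mathfrak{L}_0\times\mathfrak{L}_0})$ is standard, where $\mathrm{ad}$ is the adjoint action and $\mathfrak{L}_{-1}$ is regarded as an $\mathfrak{L}_0$-submodule of $\mathrm{Hom}(\mathfrak{L}_1,\mathfrak{k})$ via $B_{\mathfrak{L}}|_{\mathfrak{L}_1\times\mathfrak{L}_{-1}}$, and $\mathfrak{L}$ is isomorphic as a Lie algebra to $L(\mathfrak{L}_0,\mathrm{ad},\mathfrak{L}_1,\mathfrak{L}_{-1},B_{\mathfrak{L}}|_{\mathfrak{L}_0\times\mathfrak{L}_0})$, the Lie algebra associated with this standard pentad.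
   Context: All objects are over a field $\mathfrak{k}$ and may be infinite-dimensional. A representation of a Lie algebra $\mathfrak{l}$ on $V$ is written as a linear map $\rho:\mathfrak{l}\otimes V\to V$. A Lie algebra $\mathfrak{l}$ is graded if $\mathfrak{l}=\bigoplus_{n\in\mathbb{Z}}\mathfrak{l}_n$ with $[\mathfrak{l}_n,\mathfrak{l}_m]\subset\mathfrak{l}_{n+m}$ and $\mathfrak{l}$ is generated by $\mathfrak{l}_{-1}\oplus\mathfrak{l}_0\oplus\mathfrak{l}_1$. A bilinear form $B$ is invariant if $B([a,b],c)=B(a,[b,c])$. Standard pentad $(\mathfrak{g},\rho,V,\mathcal{V},B_0)$: $\mathfrak{g}$ is a non-zero Lie algebra with a non-degenerate invariant bilinear form $B_0$, $\rho:\mathfrak{g}\otimes V\to V$ is a representation, $\mathcal{V}$ is a $\mathfrak{g}$-submodule of $\mathrm{Hom}(V,\mathfrak{k})$ with canonical representation $\varrho$ (so $\langle\rho(a\otimes v),\phi\rangle=-\langle v,\varrho(a\otimes\phi)\rangle$ for the canonical pairing $\langle\cdot,\cdot\rangle$), such that (i) $\langle\cdot,\cdot\rangle$ restricted to $V\times\mathcal{V}$ is non-degenerate, (ii) there is a (necessarily unique) linear map $\Phi_\rho:V\otimes\mathcal{V}\to\mathfrak{g}$ with $B_0(a,\Phi_\rho(v\otimes\phi))=\langle\rho(a\otimes v),\phi\rangle$ for all $a,v,\phi$. Put $\Psi_\rho(\phi\otimes v):=-\Phi_\rho(v\otimes\phi)$. Associated graded Lie algebra $L(\mathfrak{g},\rho,V,\mathcal{V},B_0)=\bigoplus_{n}V_n$: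 $V_0:=\mathfrak{g}$, $V_1:=V$, $V_{-1}:=\mathcal{V}$, with canonical representations $\rho_0$ (adjoint), $\rho_1=\rho$, $\rho_{-1}=\varrho$. For $x\in V_1$, $y\in V_{-1}$ write $x(y):=\Phi_\rho(x\otimes y)$, $y(x):=\Psi_\rho(y\otimes x)$. Let $p_0(x\otimes a):=-\rho_1(a\otimes x)$, $q_0(y\otimes a):=-\rho_{-1}(a\otimes y)$ for $a\in V_0$. Define $p_1:V_1\otimes V_1\to\mathrm{Hom}(V_{-1},V_1)$ by $p_1(v\otimes u)(\eta)=\rho_1(v(\eta)\otimes u)-\rho_1(u(\eta)\otimes v)$ and $q_{-1}:V_{-1}\otimes V_{-1}\to\mathrm{Hom}(V_1,V_{-1})$ by $q_{-1}(\phi\otimes\psi)(\xi)=\rho_{-1}(\phi(\xi)\otimes\psi)-\rho_{-1}(\psi(\xi)\otimes\phi)$. For $i\ge2$, inductively, $V_i:=\mathrm{Im}\,p_{i-1}\subset\mathrm{Hom}(V_{-1},V_{i-1})$, $V_{-i}:=\mathrm{Im}\,q_{-i+1}\subset\mathrm{Hom}(V_1,V_{-i+1})$ with the canonical $\mathfrak{g}$-module structures $\rho_{i},\rho_{-i}$, and $p_i:V_1\otimes V_i\to\mathrm{Hom}(V_{-1},V_i)$, $p_i(v\otimes u)(\eta)=\rho_i(v(\eta)\otimes u)+p_{i-1}(v\otimes u(\eta))$; $q_{-i}:V_{-1}\otimes V_{-i}\to\mathrm{Hom}(V_1,V_{-i})$, $q_{-i}(\phi\otimes\psi)(\xi)=\rho_{-i}(\phi(\xi)\otimes\psi)+q_{-i+1}(\phi\otimes\psi(\xi))$.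 The Lie bracket satisfies, for $a\in V_0$, $x\in V_1$, $y\in V_{-1}$, $z_n\in V_n$: $[a,z_n]=\rho_n(a\otimes z_n)$; $[x,z_n]=p_n(x\otimes z_n)$ if $n\ge0$, $=-z_n(x)$ if $n\le-1$; $[y,z_n]=-z_n(y)$ if $n\ge1$, $=q_n(y\otimes z_n)$ if $n\le0$; and it is extended inductively ($i\ge1$) by $[p_i(x\otimes z_i),w]=[x,[z_i,w]]-[z_i,[x,w]]$, $[q_{-i}(y\otimes\omega_{-i}),w]=[y,[\omega_{-i},w]]-[\omega_{-i},[y,w]]$. It is a theorem that this is a well-defined graded Lie algebra. *)

(* Defs.v *)
From HB Require Import structures.
From mathcomp Require Import all_boot all_order all_algebra.
From mathcomp Require Import boolp classical_sets functions cardinality fsbigop.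

Set Implicit Arguments.
Unset Strict Implicit.
Unset Printing Implicit Defensive.

Import GRing.Theory.
Local Open Scope ring_scope.

Section Bilinear.
Variables (k : fieldType) (U V W : lmodType k).

Definition is_bilinear (f : U -> V -> W) : Prop :=
  (forall v, linear (f^~ v)) /\ (forall u, linear (f u)).

(* The image of S (x) T under the linear map U (x) V -> W induced by f. *)
Definition tensor_image (f : U -> V -> W) (S : U -> Prop) (T : V -> Prop)
    (w : W) : Prop :=
  exists2 s : seq (U * V), (forall t, t \in s -> S t.1 /\ T t.2)
    & w = \sum_(t <- s) f t.1 t.2.

End Bilinear.

(* Non-degeneracy is required on both sides: in infinite dimension neither
   side implies the other. *)
Definition is_nondegenerate (k : fieldType) (U V : lmodType k)
    (B : U -> V -> k^o) : Prop :=
  (forall u, (forall v, B u v = 0) -> u = 0) /\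
  (forall v, (forall u, B u v = 0) -> v = 0).

Section Submodule.
Variables (k : fieldType) (V : lmodType k).

Record submod := Submod {
  submod_pred :> V -> Prop;
  submod0 : submod_pred 0;
  submodD : forall u v, submod_pred u -> submod_pred v -> submod_pred (u + v);
  submodZ : forall a v, submod_pred v -> submod_pred (a *: v) }.

Definition submod_type (S : submod) : Type := {x : V | `[< S x >]}.

Variable S : submod.

HB.instance Definition _ := [isSub of submod_type S for @sval _ _].
HB.instance Definition _ := [Choice of submod_type S by <:].

Fact submod_subsemimod : subsemimod_closed (fun x : V => `[< S x >]).
Proof.
split; first split.
- by apply/asboolP; apply: submod0.
- by move=> u v /asboolP Su /asboolP Sv; apply/asboolP; apply: submodD.
- by move=> a v /asboolP Sv; apply/asboolP; apply: submodZ.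
Qed.

HB.instance Definition _ :=
  GRing.SubChoice_isSubLmodule.Build k V (fun x : V => `[< S x >])
    (submod_type S) submod_subsemimod.

Definition in_submod (x : V) (Sx : S x) : submod_type S :=
  exist _ x (asboolT Sx).

Lemma submod_valP (x : submod_type S) : S (val x).
Proof. by case: x => x /= /asboolP. Qed.

End Submodule.

HB.mixin Record Lmodule_isLieAlgebra (k : fieldType) L of GRing.Lmodule k L := {
  lie : L -> L -> L;
  lie_bilinear : is_bilinear lie;
  liexx : forall x, lie x x = 0;
  lie_jacobi : forall x y z,
    lie x (lie y z) + lie y (lie z x) + lie z (lie x y) = 0 }.

#[short(type="lieAlgType")]
HB.structure Definition LieAlgebra (k : fieldType) :=
  { L of Lmodule_isLieAlgebra k L & GRing.Lmodule k L }.

Section LinearTheory.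
Variables (k : fieldType) (U V : lmodType k) (f : U -> V) (lf : linear f).

Lemma linD u v : f (u + v) = f u + f v.
Proof. by have := lf 1 u v; rewrite !scale1r. Qed.
Lemma lin0 : f 0 = 0.
Proof. by have /(congr1 (fun t => t - f 0)) := linD 0 0; rewrite addr0 addrK subrr. Qed.
Lemma linZ a u : f (a *: u) = a *: f u.
Proof. by have := lf a u 0; rewrite !addr0 lin0 addr0. Qed.
Lemma linN u : f (- u) = - f u.
Proof. by rewrite -scaleN1r linZ scaleN1r. Qed.
Lemma linB u v : f (u - v) = f u - f v.
Proof. by rewrite linD linN. Qed.
Lemma lin_sum I (s : seq I) (F : I -> U) :
  f (\sum_(t <- s) F t) = \sum_(t <- s) f (F t).
Proof.
by elim: s => [|t s IH]; rewrite ?big_nil ?lin0 // !big_cons linD IH.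
Qed.
End LinearTheory.

Section BilinearTheory.
Variables (k : fieldType) (U V W : lmodType k) (f : U -> V -> W).
Hypothesis bf : is_bilinear f.

Lemma bilDl u v w : f (u + v) w = f u w + f v w.
Proof. exact: (linD (bf.1 w)). Qed.
Lemma bilDr u v w : f u (v + w) = f u v + f u w.
Proof. exact: (linD (bf.2 u)). Qed.
Lemma bilBl u v w : f (u - v) w = f u w - f v w.
Proof. exact: (linB (bf.1 w)). Qed.
Lemma bilBr u v w : f u (v - w) = f u v - f u w.
Proof. exact: (linB (bf.2 u)). Qed.
Lemma bilNl u w : f (- u) w = - f u w.
Proof. exact: (linN (bf.1 w)). Qed.
Lemma bilNr u w : f u (- w) = - f u w.
Proof. exact: (linN (bf.2 u)). Qed.
Lemma bilZl a u w : f (a *: u) w = a *: f u w.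
Proof. exact: (linZ (bf.1 w)). Qed.
Lemma bilZr a u w : f u (a *: w) = a *: f u w.
Proof. exact: (linZ (bf.2 u)). Qed.
Lemma bil0l w : f 0 w = 0.
Proof. exact: (lin0 (bf.1 w)). Qed.
Lemma bil0r u : f u 0 = 0.
Proof. exact: (lin0 (bf.2 u)). Qed.
Lemma bil_suml I (s : seq I) (F : I -> U) w :
  f (\sum_(t <- s) F t) w = \sum_(t <- s) f (F t) w.
Proof. exact: (lin_sum (bf.1 w)). Qed.
Lemma bil_sumr I (s : seq I) (F : I -> V) u :
  f u (\sum_(t <- s) F t) = \sum_(t <- s) f u (F t).
Proof. exact: (lin_sum (bf.2 u)). Qed.

Variables (S : U -> Prop) (T : V -> Prop).
Lemma tensor_image0 : tensor_image f S T 0.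
Proof. by exists [::] => //; rewrite big_nil. Qed.
Lemma tensor_imageD u v :
  tensor_image f S T u -> tensor_image f S T v -> tensor_image f S T (u + v).
Proof.
move=> [s Hs ->] [s' Hs' ->]; exists (s ++ s'); last by rewrite big_cat.
by move=> t; rewrite mem_cat => /orP[/Hs|/Hs'].
Qed.
Lemma tensor_imageZ (SZ : forall a u, S u -> S (a *: u)) a v :
  tensor_image f S T v -> tensor_image f S T (a *: v).
Proof.
move=> [s Hs ->]; exists [seq (a *: t.1, t.2) | t <- s].
  by move=> _ /mapP[t /Hs[St Tt] ->]; split=> //; apply: SZ.
rewrite big_map scaler_sumr; apply: eq_bigr => t _ /=; by rewrite bilZl.
Qed.
Lemma tensor_image1 u v : S u -> T v -> tensor_image f S T (f u v).
Proof.
move=> Su Tv; exists [:: (u, v)]; last by rewrite big_seq1.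
by move=> t; rewrite inE => /eqP->.
Qed.
End BilinearTheory.

Section LieTheory.
Variables (k : fieldType) (g : lieAlgType k).
Implicit Types a b c : g.

Lemma lieC a b : lie a b = - lie b a.
Proof.
have := liexx (a + b).
rewrite (bilDl lie_bilinear) !(bilDr lie_bilinear) !liexx add0r addr0.
by move/eqP; rewrite addr_eq0 => /eqP.
Qed.

Lemma lie_act a b c : lie (lie a b) c = lie a (lie b c) - lie b (lie a c).
Proof.
have /eqP := lie_jacobi a b c; rewrite addr_eq0 => /eqP E.
by rewrite [LHS]lieC -E (lieC c a) (bilNr lie_bilinear).
Qed.
End LieTheory.

Definition is_representation (k : fieldType) (g : lieAlgType k) (V : lmodType k)
    (rho : g -> V -> V) : Prop :=
  is_bilinear rho /\
  forall a b v, rho (lie a b) v = rho a (rho b v) - rho b (rho a v).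

(* The non-negative half of L(g,rho,V,VV,B0), for A = V_1 and B = V_{-1}, with
   Phi x y = x(y); exchanging the roles of V_1 and V_{-1} and using Psi instead
   of Phi gives the non-positive half.  [hom i] is an ambient space of iterated
   maps B -> (B -> ... -> A) which contains V_i; its operations [act], [ev],
   [pmap] are given by the formulas for rho_i, for u(y) and for p_i, and
   V_i = [Vcomp i] is the image of p_{i-1} on A (x) V_{i-1}.  The elements of
   [Vcomp i.+1] are linear maps from B to [Vcomp i]: see [ev_linear] and
   [comp_ev]. *)
Section Tower.
Variables (k : fieldType) (g : lieAlgType k) (A B : lmodType k).
Variables (rA : g -> A -> A) (rB : g -> B -> B) (Phi : A -> B -> g).

Fixpoint hom (i : nat) : lmodType k :=
  if i is i'.+1 then
    if i' is _.+1 then (B -> hom i' : lmodType k) else A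
  else g.

Fixpoint act (i : nat) : g -> hom i -> hom i :=
  match i with
  | 0 => lie
  | i'.+1 =>
    match i' return (g -> hom i' -> hom i') -> g -> hom i'.+1 -> hom i'.+1 with
    | 0 => fun _ => rA
    | _.+1 => fun act' a f y => act' a (f y) - f (rB a y)
    end (@act i')
  end.

Definition ev (i : nat) : hom i.+1 -> B -> hom i :=
  match i return hom i.+1 -> B -> hom i with
  | 0 => Phi
  | _.+1 => fun f => f
  end.

Fixpoint pmap (i : nat) : A -> hom i -> hom i.+1 :=
  match i with
  | 0 => fun x a => - rA a x
  | i'.+1 => fun x u y => @act i'.+1 (Phi x y) u + @pmap i' x (@ev i' u y)
  end.

Fixpoint Vcomp (i : nat) : hom i -> Prop :=
  match i with
  | 0 => fun _ => True
  | i'.+1 =>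
    match i' return (hom i' -> Prop) -> hom i'.+1 -> Prop with
    | 0 => fun _ _ => True
    | j.+1 => fun Vcomp' => tensor_image (@pmap j.+1) (fun=> True) Vcomp'
    end (@Vcomp i')
  end.

Arguments hom : simpl never.
Arguments act : simpl never.
Arguments ev : simpl never.
Arguments pmap : simpl never.
Arguments Vcomp : simpl never.

Hypotheses (rArep : is_representation rA) (rBrep : is_representation rB).
Hypotheses (Phi_bil : is_bilinear Phi)
  (Phi_equiv : forall a x y,
     lie a (Phi x y) = Phi (rA a x) y + Phi x (rB a y)).

Lemma actS i a (f : hom i.+2) y :
  @act i.+2 a f y = @act i.+1 a (f y) - f (rB a y).
Proof. by []. Qed.

Lemma pmapS i x (u : hom i.+1) y :
  @pmap i.+1 x u y = act (Phi x y) u + pmap x (ev u y).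
Proof. by []. Qed.

Lemma pmap0 x (a : g) : @pmap 0 x a = - rA a x.
Proof. by []. Qed.

Lemma act0 (a b : g) : @act 0 a b = lie a b.
Proof. by []. Qed.

Lemma act1 a (x : A) : @act 1 a x = rA a x.
Proof. by []. Qed.

Lemma ev0 (x : A) y : @ev 0 x y = Phi x y.
Proof. by []. Qed.

Lemma evS i (f : hom i.+2) y : @ev i.+1 f y = f y.
Proof. by []. Qed.

Lemma homD i (f h : hom i.+2) y : (f + h) y = f y + h y.
Proof. by []. Qed.

Lemma homZ i c (f : hom i.+2) y : (c *: f) y = c *: f y.
Proof. by []. Qed.

Lemma hom_sum i I (s : seq I) (F : I -> hom i.+2) y :
  (\sum_(t <- s) F t) y = \sum_(t <- s) (F t y).
Proof. by rewrite fct_sumE. Qed.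

Lemma act_linr i a : linear (@act i a).
Proof.
elim: i => [|[|i] IH]; [exact: lie_bilinear.2 | exact: rArep.1.2 |].
move=> c f h; apply/funext => y.
rewrite homD homZ !actS !homD !homZ IH.
by rewrite opprD addrACA -scalerBr.
Qed.

Lemma ev_linl i y : linear (@ev i ^~ y).
Proof. by case: i => [|i]; [exact: Phi_bil.1 | move=> c f h]. Qed.

Lemma pmap_linr i x : linear (@pmap i x).
Proof.
elim: i => [|i IH] c u v; first by rewrite !pmap0 rArep.1.1 opprD scalerN.
apply/funext => y; rewrite homD homZ !pmapS.
by rewrite act_linr ev_linl IH addrACA -scalerDr.
Qed.

Lemma ev_equiv i a u y :
  act a (@ev i u y) = ev (act a u) y + ev u (rB a y).
Proof. by case: i u => [|i] u; [exact: Phi_equiv | rewrite !evS actS subrK]. Qed.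

Lemma compD i u v : @Vcomp i u -> Vcomp v -> Vcomp (u + v).
Proof. by case: i u v => [|[|i]] // u v; apply: tensor_imageD. Qed.

Lemma comp0 i : @Vcomp i 0.
Proof. by case: i => [|[|i]] //; apply: tensor_image0. Qed.

Lemma comp_sum i (I : eqType) (s : seq I) (F : I -> hom i) :
  (forall t, t \in s -> Vcomp (F t)) -> Vcomp (\sum_(t <- s) F t).
Proof.
by move=> CF; rewrite big_seq; apply: big_ind => //; [apply: comp0 | apply: compD].
Qed.

Lemma comp_pmap i x u : @Vcomp i u -> Vcomp (pmap x u).
Proof. by case: i u => [|i] // u Cu; apply: (tensor_image1 (@pmap i.+1)). Qed.

Definition comp_prop i (z : hom i) : Prop :=
  [/\ linear (@act i ^~ z),
      forall a b, act (lie a b) z = act a (act b z) - act b (act a z),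
      forall a, Vcomp (act a z),
      forall a x, act a (pmap x z) = pmap (rA a x) z + pmap x (act a z) &
      match i return hom i -> Prop with
      | 0 => fun=> True
      | j.+1 => fun z => linear (ev z) /\ forall y, @Vcomp j (ev z y)
      end z].

Lemma pmap_equiv_step i (u : hom i.+1) a x :
    linear (@act i.+1 ^~ u) ->
    (forall a b, act (lie a b) u = act a (act b u) - act b (act a u)) ->
    (forall y a x, act a (pmap x (ev u y)) =
       pmap (rA a x) (ev u y) + pmap x (act a (ev u y))) ->
  act a (pmap x u) = pmap (rA a x) u + pmap x (act a u).
Proof.
move=> Lu Ru Pu; apply/funext => y; rewrite homD actS !pmapS.
rewrite (linD (act_linr _)) Pu ev_equiv (linD (pmap_linr _)).
have -> : act a (act (Phi x y) u) =
    act (Phi (rA a x) y) u + act (Phi x (rB a y)) u + act (Phi x y) (act a u).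
  by rewrite -(linD Lu) -Phi_equiv Ru subrK.
rewrite opprD !addrA [LHS](ACl (1*4*3*5*(2*7)*(6*8)))%AC /=.
by rewrite !subrr !addr0 -!addrA.
Qed.

Lemma compP i (z : hom i) : Vcomp z -> comp_prop z.
Proof.
elim: i z => [z _|[|i] IH].
- split=> //; [exact: lie_bilinear.1 | by move=> a b; apply: lie_act |].
  by move=> a x; rewrite !pmap0 !act1 act0 rArep.2 opprB (linN (rArep.1.2 _)) addKr.
- move=> z _; split=> //.
  + exact: rArep.1.1.
  + by move=> a b; apply: rArep.2.
  + move=> a x; apply: pmap_equiv_step; first exact: rArep.1.1.
      by move=> b c; apply: rArep.2.
    by move=> y b x'; rewrite !pmap0 !act1 act0 rArep.2 opprB (linN (rArep.1.2 _)) addKr.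
  + by split=> //; apply: Phi_bil.2.
move=> z [s Hs zE].
have us t : t \in s -> comp_prop t.2 by case/Hs => _ /IH.
have Elin : linear (ev z).
  move=> c y y'; rewrite !evS zE !hom_sum scaler_sumr -big_split !big_seq.
  apply: eq_bigr => t /us[Lu _ _ _ [Le _]].
  rewrite !pmapS Phi_bil.2 Lu Le pmap_linr.
  by rewrite addrACA -scalerDr.
have Ecomp y : Vcomp (ev z y).
  rewrite !evS zE hom_sum; apply: comp_sum => t /us[_ _ Cu _ [_ Ce]].
  by rewrite pmapS; apply: compD => //; apply: comp_pmap.
have Llin : linear (@act i.+2 ^~ z).
  move=> c a b; apply/funext => y; rewrite homD homZ !actS.
  have [Lu _ _ _ _] := IH _ (Ecomp y).
  rewrite rBrep.1.1 (linD Lu) (linZ Lu).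
  have -> : z (c *: rB a y + rB b y) = c *: z (rB a y) + z (rB b y).
    exact: Elin.
  by rewrite opprD addrACA -scalerBr.
have Lrep a b : act (lie a b) z = act a (act b z) - act b (act a z).
  apply/funext => y; have [_ Ru _ _ _] := IH _ (Ecomp y).
  change ((act a (act b z) - act b (act a z)) y)
    with (act a (act b z) y - act b (act a z) y).
  rewrite !actS Ru rBrep.2.
  have -> : z (rB a (rB b y) - rB b (rB a y)) =
      z (rB a (rB b y)) - z (rB b (rB a y)) by exact: (linB Elin).
  rewrite !(linB (act_linr _)) !opprB !addrA.
  by rewrite [RHS](ACl (1*8*3*6*(5*2)*(7*4)))%AC /= !subrr !addr0 evS.
have Lequiv t a x : t \in s -> act a (pmap x t.2) = pmap (rA a x) t.2 + pmap x (act a t.2).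
  by move=> /us[].
split=> //.
- move=> a; rewrite zE (lin_sum (act_linr _)); apply: comp_sum => t ts.
  rewrite Lequiv //; have [_ _ Ca _ _] := us t ts.
  by apply: compD; apply: comp_pmap => //; have [] := Hs _ ts.
- by move=> a x; apply: pmap_equiv_step => // y b x'; have [] := IH _ (Ecomp y).
Qed.

Lemma act_linl i (z : hom i) : Vcomp z -> linear (@act i ^~ z).
Proof. by case/compP. Qed.

Lemma act_lie i (z : hom i) a b :
  Vcomp z -> act (lie a b) z = act a (act b z) - act b (act a z).
Proof. by case/compP. Qed.

Lemma comp_act i (z : hom i) a : Vcomp z -> Vcomp (act a z).
Proof. by case/compP. Qed.

Lemma pmap_equiv i (z : hom i) a x :
  Vcomp z -> act a (pmap x z) = pmap (rA a x) z + pmap x (act a z).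
Proof. by case/compP. Qed.

Lemma ev_linear i (z : hom i.+1) : Vcomp z -> linear (ev z).
Proof. by case/compP => _ _ _ _ []. Qed.

Lemma comp_ev i (z : hom i.+1) y : Vcomp z -> Vcomp (ev z y).
Proof. by case/compP => _ _ _ _ [_]. Qed.

Lemma pmap_linl i (u : hom i) : Vcomp u -> linear (@pmap i ^~ u).
Proof.
elim: i u => [u _|i IH u Cu] c x x'.
  by rewrite !pmap0 rArep.1.2 opprD scalerN.
apply/funext => y; rewrite homD homZ !pmapS Phi_bil.1 (linD (act_linl Cu)).
rewrite (linZ (act_linl Cu)) (linD (IH _ (comp_ev y Cu))).
by rewrite (linZ (IH _ (comp_ev y Cu))) addrACA -scalerDr.
Qed.

Lemma compZ i c (u : hom i) : Vcomp u -> Vcomp (c *: u).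
Proof.
case: i u => [|[|i]] // u [s Hs ->]; rewrite scaler_sumr; apply: comp_sum => t.
move=> /Hs[_ Ct].
have <- := linZ (pmap_linl Ct) c t.1; exact: comp_pmap.
Qed.

End Tower.
(* The bracket with an element of V_i for i >= 0: [D a] and [X x] are the
   brackets with a in V_0 and x in V_1, and for i >= 2 the bracket with
   sum_t p_{i-1}(x_t (x) z_t) is sum_t (ad x_t o ad z_t - ad z_t o ad x_t).
   A decomposition is chosen; [adE] below shows that the choice does not
   matter. *)
Section AdDef.
Variables (k : fieldType) (g : lieAlgType k) (A B : lmodType k).
Variables (rA : g -> A -> A) (rB : g -> B -> B) (Phi : A -> B -> g).
Variables (P : lmodType k) (D : g -> P -> P) (X : A -> P -> P).

Definition decomp i (z : hom g A B i.+2) : seq (A * hom g A B i.+1) :=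
  xget [::] (fun s : seq (A * hom g A B i.+1) =>
    (forall t, t \in s -> Vcomp rA rB Phi t.2) /\
    z = \sum_(t <- s) pmap rA rB Phi t.1 t.2).

Fixpoint ad (i : nat) : hom g A B i -> P -> P :=
  match i with
  | 0 => D
  | i'.+1 =>
    match i' return (hom g A B i' -> P -> P) -> hom g A B i'.+1 -> P -> P with
    | 0 => fun _ => X
    | _.+1 => fun ad' z w =>
        \sum_(t <- decomp z) (X t.1 (ad' t.2 w) - ad' t.2 (X t.1 w))
    end (@ad i')
  end.
End AdDef.
Arguments ad : simpl never.

(* Well-definedness of [ad].  Stated abstractly because it is applied twice,
   with V_1 and V_{-1} exchanged.  P is the product of all the [hom i], T the
   direct sum of the V_n, and Fp m the families vanishing in degrees below m. *)
Section AdTheory.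
Variables (k : fieldType) (g : lieAlgType k) (A B : lmodType k).
Variables (rA : g -> A -> A) (rB : g -> B -> B).
Variables (Phi : A -> B -> g) (Psi : B -> A -> g).
Hypotheses (rArep : is_representation rA) (rBrep : is_representation rB).
Hypotheses (Phi_bil : is_bilinear Phi)
  (Phi_equiv : forall a x y,
     lie a (Phi x y) = Phi (rA a x) y + Phi x (rB a y)).
Hypothesis PsiE : forall y x, Psi y x = - Phi x y.

Local Notation hp := (hom g A B).
Local Notation hm := (hom g B A).
Local Notation actp := (act rA rB).
Local Notation actm := (act rB rA).
Local Notation evp := (ev Phi).
Local Notation evm := (ev Psi).
Local Notation pp := (pmap rA rB Phi).
Local Notation pm := (pmap rB rA Psi).
Local Notation cp := (Vcomp rA rB Phi).
Local Notation cm := (Vcomp rB rA Psi).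

Variables (P : lmodType k) (T : P -> Prop).
Variables (D : g -> P -> P) (X : A -> P -> P) (Y : B -> P -> P).
Variables (ip : forall i, hp i -> P) (im : forall i, hm i -> P).
Variable Fp : nat -> P -> Prop.

Hypotheses (Dlin : forall a, linear (D a)) (Xlin : forall a, linear (X a))
  (Ylin : forall a, linear (Y a)).
Hypotheses (DlinT : forall w, T w -> linear (D ^~ w))
  (XlinT : forall w, T w -> linear (X ^~ w)).
Hypotheses (TD : forall a w, T w -> T (D a w))
  (TX : forall x w, T w -> T (X x w)) (TY : forall y w, T w -> T (Y y w)).
Hypotheses (T0 : T 0) (Tadd : forall u v, T u -> T v -> T (u + v))
  (Topp : forall u, T u -> T (- u)).
Hypotheses (Tip : forall i z, cp z -> T (@ip i z))
  (Tim : forall i z, cm z -> T (@im i z)).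
Hypothesis Tind : forall Q : P -> Prop, Q 0 ->
  (forall u v, T u -> T v -> Q u -> Q v -> Q (u + v)) ->
  (forall i z, cp z -> Q (@ip i z)) -> (forall i z, cm z -> Q (@im i z)) ->
  forall w, T w -> Q w.
Hypotheses (iplin : forall i, linear (@ip i)) (imlin : forall i, linear (@im i)).
Hypothesis ip0 : forall a : g, @ip 0 a = @im 0 a.
Hypotheses (XP : forall i x z, X x (@ip i z) = @ip i.+1 (pp x z))
  (XM : forall i x z, X x (@im i.+1 z) = - @im i (evm z x))
  (YP : forall i y z, Y y (@ip i.+1 z) = - @ip i (evp z y))
  (YM : forall i y z, Y y (@im i z) = @im i.+1 (pm y z))
  (DP : forall i a z, D a (@ip i z) = @ip i (actp a z))
  (DM : forall i a z, D a (@im i z) = @im i (actm a z)).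
Hypotheses
  (DX : forall a x w, T w -> D a (X x w) = X (rA a x) w + X x (D a w))
  (XY : forall x y w, T w -> X x (Y y w) = Y y (X x w) + D (Phi x y) w).
Hypotheses (FpD : forall m u v, Fp m u -> Fp m v -> Fp m (u + v))
  (FpN : forall m u, Fp m u -> Fp m (- u)) (Fp0 : forall m, Fp m 0)
  (FpS : forall m u, Fp m.+1 u -> Fp m u)
  (Fip : forall m i z, (m <= i)%N -> Fp m (@ip i z))
  (FX : forall m x u, Fp m u -> Fp m.+1 (X x u))
  (Ftrans : forall u, Fp 2 u -> (forall y, Y y u = 0) -> u = 0).

Local Notation adp := (@ad k g A B rA rB Phi P D X).

Lemma kill (e : P -> P) :
  linear e -> (forall m w, Fp m w -> Fp m.+1 (e w)) ->
  (forall y w, T w -> e (Y y w) = Y y (e w)) ->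
  (forall a, e (@ip 0 a) = 0) -> (forall x, e (@ip 1 x) = 0) ->
  (forall y, e (@im 1 y) = 0) ->
  forall w, T w -> e w = 0.
Proof.
move=> elin eF eY eG eX eN; apply: Tind.
- exact: (lin0 elin).
- by move=> u v _ _ eu ev'; rewrite (linD elin) eu ev' addr0.
- elim=> [|[|i] IH] z Cz //; apply: Ftrans.
    apply/FpS/eF/Fip; by [].
  move=> y; rewrite -eY; last exact: Tip.
  rewrite YP (linN elin) IH ?oppr0 //.
  exact: (comp_ev rArep rBrep Phi_bil Phi_equiv y Cz).
- elim=> [|[|i] IH] z Cz //; first by rewrite -ip0.
  have [s Hs ->] := Cz.
  rewrite (lin_sum (@imlin _)) (lin_sum elin) big_seq big1 // => t /Hs[_ Ct].
  by rewrite -YM eY ?IH ?(lin0 (Ylin _)) //; apply: Tim.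
Qed.

Record ad_inv (i : nat) : Prop := AdInv {
  ai_lin : forall z, cp z -> linear (@adp i.+1 z);
  ai_linl : forall c z z' w, cp z -> cp z' -> T w ->
    @adp i.+1 (c *: z + z') w = c *: adp z w + adp z' w;
  ai_T : forall z w, cp z -> T w -> T (@adp i.+1 z w);
  ai_F : forall m z w, cp z -> Fp m w -> Fp m.+1 (@adp i.+1 z w);
  ai_D : forall z a w, cp z -> T w ->
    D a (@adp i.+1 z w) = @adp i.+1 (actp a z) w + adp z (D a w);
  ai_Y : forall z y w, cp z -> T w ->
    @adp i.+1 z (Y y w) = Y y (adp z w) + @adp i (evp z y) w;
  ai_G : forall z a, cp z -> @adp i.+1 z (@ip 0 a) = - ip (actp a z);
  ai_X : forall z x, cp z -> @adp i.+1 z (@ip 1 x) = - ip (pp x z);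
  ai_N : forall z y, cp z -> @adp i.+1 z (@im 1 y) = ip (evp z y);
  ai_p : forall x v w, cp v -> T w ->
    @adp i.+1 (pp x v) w = X x (@adp i v w) - @adp i v (X x w) }.

Lemma ad_inv0 : ad_inv 0.
Proof.
split.
- by move=> z _; apply: Xlin.
- by move=> c z z' w _ _ Tw; apply: (XlinT Tw).
- by move=> z w _; apply: TX.
- by move=> m z w _; apply: FX.
- by move=> z a w _; apply: DX.
- by move=> z y w _; apply: XY.
- by move=> z a _; rewrite [LHS]XP pmap0 (linN (@iplin _)).
- move=> z x _; rewrite [LHS]XP -(linN (@iplin _)); congr ip.
  apply/funext => y; rewrite pmapS.
  change (actp (Phi z y) x + pp z (evp x y) =
    - (actp (Phi x y) z + pp x (evp z y))).
  by rewrite !pmap0 !act1 !ev0 opprD opprK addrC.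
- move=> z y _; rewrite [LHS]XM -ip0 -(linN (@iplin _)); congr ip.
  by rewrite !ev0 PsiE opprK.
- move=> x v w _ Tw; have E := DX v x Tw.
  change (X (- rA v x) w = X x (D v w) - D v (X x w)).
  by rewrite (linN (XlinT Tw)) E opprD addrCA subrr addr0.
Qed.

Section Step.
Variable i : nat.
Hypothesis H : ad_inv i.

Definition adW (s : seq (A * hp i.+1)) (w : P) : P :=
  \sum_(t <- s) (X t.1 (adp t.2 w) - adp t.2 (X t.1 w)).
Definition okW (s : seq (A * hp i.+1)) := forall t, t \in s -> cp t.2.
Definition zW (s : seq (A * hp i.+1)) : hp i.+2 :=
  \sum_(t <- s) pp t.1 t.2.

Lemma zW_comp s : okW s -> cp (zW s).
Proof.
by move=> Hs; apply: comp_sum => t /Hs Ct; apply: comp_pmap.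
Qed.

Lemma zW_cat s s' : zW (s ++ s') = zW s + zW s'.
Proof. exact: big_cat. Qed.

Lemma adW_lin s : okW s -> linear (adW s).
Proof.
move=> Hs c u v; rewrite /adW scaler_sumr -big_split !big_seq.
apply: eq_bigr => t /Hs Ct; rewrite (linD (Xlin _)) (linZ (Xlin _)).
rewrite !(linD (ai_lin H Ct)) !(linZ (ai_lin H Ct)).
by rewrite (linD (Xlin _)) (linZ (Xlin _)) opprD addrACA -scalerBr.
Qed.

Lemma sumT (I : eqType) (s : seq I) (F : I -> P) :
  (forall t, t \in s -> T (F t)) -> T (\sum_(t <- s) F t).
Proof. by move=> Hs; rewrite big_seq; apply: big_ind. Qed.

Lemma adW_T s w : okW s -> T w -> T (adW s w).
Proof.
move=> Hs Tw; apply: sumT => t /Hs Ct; apply/Tadd/Topp.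
  by apply/TX/(ai_T H).
by apply/(ai_T H) => //; apply: TX.
Qed.

Lemma adW_F s m w : okW s -> Fp m w -> Fp m.+1 (adW s w).
Proof.
move=> Hs Fw; rewrite /adW big_seq; apply: big_ind => //; first exact: FpD.
move=> t /Hs Ct; apply: FpD; last apply: FpN.
  by apply/FpS/FX/(ai_F H).
by apply/FpS/(ai_F H) => //; apply: FX.
Qed.

Lemma adW_Y s y w : okW s -> T w ->
  adW s (Y y w) = Y y (adW s w) + @adp i.+1 (evp (zW s) y) w.
Proof.
move=> Hs Tw.
have Cev t : t \in s -> cp (evp (pp t.1 t.2) y).
  by move=> /Hs Ct; apply: comp_ev => //; apply: comp_pmap.
have -> : @adp i.+1 (evp (zW s) y) w =
    \sum_(t <- s) @adp i.+1 (evp (pp t.1 t.2) y) w.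
  rewrite /zW evS hom_sum; elim: s Hs Cev => [|t s IH] Hs Cev.
    rewrite !big_nil.
    have := ai_linl H 1 (comp0 rA rB Phi i.+1) (comp0 rA rB Phi i.+1) Tw.
    rewrite !scale1r addr0 => /(congr1 (fun v => v - @adp i.+1 0 w)).
    by rewrite subrr addrK.
  rewrite !big_cons -[X in _ = X + _]scale1r -IH; first last.
  - by move=> t' t's; apply: Cev; rewrite inE t's orbT.
  - by move=> t' t's; apply: Hs; rewrite inE t's orbT.
  rewrite -(ai_linl H) ?scale1r //; first by apply: Cev; rewrite inE eqxx.
  by apply: comp_sum => t' t's; apply: (Cev t'); rewrite inE t's orbT.
rewrite /adW (lin_sum (Ylin _)) -big_split !big_seq; apply: eq_bigr => t ts.
have Ct := Hs t ts; case: t {ts} Ct => x u Cu; rewrite [(x, u).1]/= [(x, u).2]/=.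
have Cv : cp (evp u y) by apply: comp_ev.
rewrite (ai_Y H) // XY // (linD (Xlin _)) XY; last exact: (ai_T H).
rewrite (linD (ai_lin H Cu)) (ai_Y H) //; last exact: TX.
rewrite (ai_D H) // evS pmapS -[X in X + pp _ _]scale1r (ai_linl H) //; first last.
- exact: comp_pmap.
- exact: comp_act.
rewrite scale1r (ai_p H) // (linB (Ylin _)) !opprD !addrA.
rewrite [LHS](ACl ((1*5)*(2*4*6)*(3*7)))%AC.
by rewrite [X in _ + X = _]subrr addr0.
Qed.

Lemma adW_D s a w : okW s -> T w ->
  D a (adW s w) = adW [seq (rA a t.1, t.2) | t <- s] w
    + adW [seq (t.1, actp a t.2) | t <- s] w + adW s (D a w).
Proof.
move=> Hs Tw; rewrite /adW !big_map (lin_sum (Dlin _)) -!big_split !big_seq.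
apply: eq_bigr => t /Hs; case: t => x u Cu; rewrite [(x, u).1]/= [(x, u).2]/=.
rewrite (linB (Dlin _)) DX; last exact: (ai_T H).
rewrite (ai_D H) // (linD (Xlin _)) (ai_D H) //; last exact: TX.
rewrite DX // (linD (ai_lin H Cu)) !opprD !addrA.
by rewrite [LHS](ACl ((1*5)*(2*4)*(3*6)))%AC.
Qed.

Lemma adW_G s a : okW s -> adW s (@ip 0 a) = - ip (actp a (zW s)).
Proof.
move=> Hs; rewrite /adW /zW (lin_sum (act_linr rB rArep _)) (lin_sum (@iplin _)).
rewrite -sumrN !big_seq; apply: eq_bigr => t /Hs.
case: t => x u Cu; rewrite [(x, u).1]/= [(x, u).2]/=.
rewrite (ai_G H) // XP pmap0 (linN (@iplin _)) (linN (ai_lin H Cu)).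
rewrite (ai_X H) // (linN (Xlin _)) XP pmap_equiv // (linD (@iplin _)).
by rewrite opprK opprD addrC.
Qed.

Lemma adW_N s y : okW s -> adW s (@im 1 y) = ip (evp (zW s) y).
Proof.
move=> Hs; rewrite /adW /zW evS hom_sum (lin_sum (@iplin _)) !big_seq.
apply: eq_bigr => t /Hs.
case: t => x u Cu; rewrite [(x, u).1]/= [(x, u).2]/=.
rewrite (ai_N H) // XP XM -ip0 ev0 PsiE -(linN (@iplin _)) opprK.
by rewrite (ai_G H) // pmapS opprK addrC -(linD (@iplin _)).
Qed.

Lemma adW_X s x : okW s -> adW s (@ip 1 x) = - ip (pp x (zW s)).
Proof.
move=> Hs; have Cz := zW_comp Hs; apply/eqP; rewrite -subr_eq0 opprK.
apply/eqP/Ftrans.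
  apply: FpD; first by apply/adW_F => //; apply: Fip.
  by apply: Fip.
move=> y; rewrite (linD (Ylin _)) YP.
have -> : Y y (adW s (@ip 1 x)) =
    adW s (Y y (@ip 1 x)) - @adp i.+1 (evp (zW s) y) (@ip 1 x).
  by rewrite adW_Y ?addrK //; apply: Tip.
have Cv : cp (evp (zW s) y) by apply: comp_ev.
rewrite YP (linN (adW_lin Hs)) adW_G // opprK (ai_X H) // opprK.
by rewrite -(linD (@iplin _)) -pmapS subrr.
Qed.

Lemma adW_indep s s' w : okW s -> okW s' -> zW s = zW s' -> T w ->
  adW s w = adW s' w.
Proof.
move=> Hs Hs' zE Tw; apply/eqP; rewrite -subr_eq0; apply/eqP; move: w Tw.
apply: kill.
- move=> c u v; rewrite !(linD (adW_lin _)) // !(linZ (adW_lin _)) //.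
  by rewrite opprD addrACA -scalerBr.
- by move=> m w Fw; apply: FpD; last apply: FpN; apply: adW_F.
- move=> y w Tw; rewrite !adW_Y // zE (linB (Ylin _)).
  by rewrite opprD addrACA subrr addr0.
- by move=> a; rewrite !adW_G // zE subrr.
- by move=> x; rewrite !adW_X // zE subrr.
- by move=> y; rewrite !adW_N // zE subrr.
Qed.

Lemma decompP (z : hp i.+2) : cp z ->
  okW (decomp rA rB Phi z) /\ z = zW (decomp rA rB Phi z).
Proof.
move=> Cz; rewrite /decomp; set Q := (Q in xget _ Q).
suff : Q (xget [::] Q) by [].
by apply: xgetPex; case: Cz => s Hs zE; exists s; split=> // t /Hs[].
Qed.

Lemma adS (z : hp i.+2) : @adp i.+2 z = adW (decomp rA rB Phi z).
Proof. by []. Qed.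

Lemma adE s w : okW s -> T w -> @adp i.+2 (zW s) w = adW s w.
Proof.
move=> Hs Tw; have [Hd zE] := decompP (zW_comp Hs).
by rewrite adS; apply: adW_indep.
Qed.

Lemma ad_invS : ad_inv i.+1.
Proof.
split.
- by move=> z /decompP[Hd _]; rewrite adS; apply: adW_lin.
- move=> c z z' w /decompP[Hd zE] /decompP[Hd' zE'] Tw.
  set s := decomp _ _ _ z in Hd zE; set s' := decomp _ _ _ z' in Hd' zE'.
  have -> : c *: z + z' = zW ([seq (c *: t.1, t.2) | t <- s] ++ s').
    rewrite zE zE' zW_cat /zW big_map scaler_sumr; congr (_ + _).
    rewrite !big_seq; apply: eq_bigr => t /Hd Ct /=.
    by have <- := linZ (pmap_linl rArep rBrep Phi_bil Phi_equiv Ct) c t.1.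
  rewrite adE //; last first.
    by move=> t; rewrite mem_cat => /orP[/mapP[t' /Hd Ct' ->]|/Hd'].
  rewrite !adS -/s -/s' /adW big_cat big_map scaler_sumr; congr (_ + _).
  rewrite !big_seq; apply: eq_bigr => t /Hd Ct.
  case: t Ct => x u Cu; rewrite [(x, u).1]/= [(x, u).2]/=.
  have TE := ai_T H Cu Tw.
  rewrite (linZ (XlinT TE)) (linZ (XlinT Tw)) (linZ (ai_lin H Cu)).
  by rewrite -scalerBr.
- by move=> z w /decompP[Hd _] Tw; rewrite adS; apply: adW_T.
- by move=> m z w /decompP[Hd _]; rewrite adS; apply: adW_F.
- move=> z a w /decompP[Hd zE] Tw; rewrite (adS z) adW_D //; congr (_ + _).
  move: (decomp _ _ _ z) Hd zE => s Hd ->.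
  have -> : actp a (zW s) = zW ([seq (rA a t.1, t.2) | t <- s]
      ++ [seq (t.1, actp a t.2) | t <- s]).
    rewrite zW_cat /zW !big_map -big_split (lin_sum (act_linr rB rArep _)).
    by rewrite !big_seq; apply: eq_bigr => t /Hd Ct; apply: pmap_equiv.
  rewrite adE //; first by rewrite /adW big_cat.
  move=> t; rewrite mem_cat => /orP[] /mapP[t' /Hd Ct' ->] //.
  exact: comp_act.
- move=> z y w /decompP[Hd zE] Tw; rewrite adS adW_Y //.
  by rewrite -zE.
- by move=> z a /decompP[Hd zE]; rewrite adS adW_G // -zE.
- by move=> z a /decompP[Hd zE]; rewrite adS adW_X // -zE.
- by move=> z a /decompP[Hd zE]; rewrite adS adW_N // -zE.
- move=> x v w Cv Tw.
  have -> : pp x v = zW [:: (x, v)] by rewrite /zW big_seq1.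
  rewrite adE //; first by rewrite /adW big_seq1.
  by move=> t; rewrite inE => /eqP->.
Qed.
End Step.

Lemma adP i : ad_inv i.
Proof. by elim: i => [|i]; [apply: ad_inv0 | apply: ad_invS]. Qed.

End AdTheory.
Section DirectProduct.
Variables (k : fieldType) (I : Type) (F : I -> lmodType k).

Definition dprod : Type := forall n, F n.
Implicit Types f h : dprod.

HB.instance Definition _ := gen_eqMixin dprod.
HB.instance Definition _ := gen_choiceMixin dprod.

Let addf f h : dprod := fun n => f n + h n.
Let oppf f : dprod := fun n => - f n.
Let scalef (c : k) f : dprod := fun n => c *: f n.

Fact dprod_addA : associative addf.
Proof. by move=> f h e; apply/functional_extensionality_dep => n; apply: addrA. Qed.
Fact dprod_addC : commutative addf.
Proof. by move=> f h; apply/functional_extensionality_dep => n; apply: addrC. Qed.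
Fact dprod_add0 : left_id (fun n => 0 : F n) addf.
Proof. by move=> f; apply/functional_extensionality_dep => n; apply: add0r. Qed.
Fact dprod_addN : left_inverse (fun n => 0 : F n) oppf addf.
Proof. by move=> f; apply/functional_extensionality_dep => n; apply: addNr. Qed.

HB.instance Definition _ :=
  GRing.isZmodule.Build dprod dprod_addA dprod_addC dprod_add0 dprod_addN.

Fact dprod_scaleA a b f : scalef a (scalef b f) = scalef (a * b) f.
Proof. by apply/functional_extensionality_dep => n; apply: scalerA. Qed.
Fact dprod_scale1 : left_id 1 scalef.
Proof. by move=> f; apply/functional_extensionality_dep => n; apply: scale1r. Qed.
Fact dprod_scaleDr : right_distributive scalef +%R.
Proof. by move=> a f h; apply/functional_extensionality_dep => n; apply: scalerDr. Qed.
Fact dprod_scaleDl f : {morph scalef^~ f : a b / a + b}.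
Proof. by move=> a b; apply/functional_extensionality_dep => n; apply: scalerDl. Qed.

HB.instance Definition _ := GRing.Zmodule_isLmodule.Build k dprod
  dprod_scaleA dprod_scale1 dprod_scaleDr dprod_scaleDl.

Lemma dprodP f h : (forall n, f n = h n) -> f = h.
Proof. by move=> fh; apply/functional_extensionality_dep => n; apply: fh. Qed.

Lemma dprodD f h n : (f + h) n = f n + h n. Proof. by []. Qed.
Lemma dprodZ c f n : (c *: f) n = c *: f n. Proof. by []. Qed.
Lemma dprodN f n : (- f) n = - f n. Proof. by []. Qed.
Lemma dprod0 n : (0 : dprod) n = 0. Proof. by []. Qed.
End DirectProduct.

Section Associated.
Variables (k : fieldType) (g : lieAlgType k) (A B : lmodType k).
Variables (rA : g -> A -> A) (rB : g -> B -> B) (Phi : A -> B -> g).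

Definition flip_Phi (y : B) (x : A) : g := - Phi x y.
Local Notation Psi := flip_Phi.

Local Notation hp := (hom g A B).
Local Notation hm := (hom g B A).
Local Notation actp := (act rA rB).
Local Notation actm := (act rB rA).
Local Notation evp := (ev Phi).
Local Notation evm := (ev Psi).
Local Notation pp := (pmap rA rB Phi).
Local Notation pm := (pmap rB rA Psi).
Local Notation cp := (Vcomp rA rB Phi).
Local Notation cm := (Vcomp rB rA Psi).

Definition piece (n : int) : lmodType k :=
  match n with Posz i => hp i | Negz i => hm i.+1 end.

Definition piece_comp (n : int) : piece n -> Prop :=
  match n return piece n -> Prop with Posz i => @cp i | Negz i => @cm i.+1 end.

Local Notation P := (dprod piece).

Definition opD (a : g) (w : P) : P := fun n =>
  match n return piece n with
  | Posz i => actp a (w (Posz i))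
  | Negz i => actm a (w (Negz i))
  end.

Definition opX (x : A) (w : P) : P := fun n =>
  match n return piece n with
  | Posz 0 => - @evm 0 (w (Negz 0)) x
  | Posz i.+1 => pp x (w (Posz i))
  | Negz i => - @evm i.+1 (w (Negz i.+1)) x
  end.

Definition opY (y : B) (w : P) : P := fun n =>
  match n return piece n with
  | Posz i => - evp (w (Posz i.+1)) y
  | Negz 0 => @pm 0 y (w (Posz 0))
  | Negz i.+1 => @pm i.+1 y (w (Negz i))
  end.

Definition ad_piece (n : int) : piece n -> P -> P :=
  match n return piece n -> P -> P with
  | Posz i => @ad k g A B rA rB Phi P opD opX i
  | Negz i => @ad k g B A rB rA Psi P opD opY i.+1
  end.

Definition bracket (f w : P) : P :=
  \sum_(n \in [set: int]) ad_piece (f n) w.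

(* The direct sum of the V_n. *)
Definition dsum (f : P) : Prop :=
  finite_set [set n | f n != 0] /\ forall n, piece_comp (f n).

Hypotheses (rArep : is_representation rA) (rBrep : is_representation rB).
Hypotheses (Phi_bil : is_bilinear Phi)
  (Phi_equiv : forall a x y,
     lie a (Phi x y) = Phi (rA a x) y + Phi x (rB a y)).

Lemma Psi_bil : is_bilinear Psi.
Proof.
by split=> v c u w; rewrite /Psi (Phi_bil.2, Phi_bil.1) opprD scalerN.
Qed.

Lemma Psi_equiv a y x : lie a (Psi y x) = Psi (rB a y) x + Psi y (rA a x).
Proof. by rewrite /Psi (bilNr lie_bilinear) Phi_equiv opprD addrC. Qed.

Lemma piece_comp0 n : @piece_comp n 0.
Proof. by case: n => n; apply: comp0. Qed.

Lemma piece_compD n u v : @piece_comp n u -> piece_comp v -> piece_comp (u + v).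
Proof. by case: n u v => n u v; apply: compD. Qed.

Lemma piece_compZ n c u : @piece_comp n u -> piece_comp (c *: u).
Proof.
case: n u => n u; first exact: (compZ rArep rBrep Phi_bil Phi_equiv).
exact: (compZ rBrep rArep Psi_bil Psi_equiv).
Qed.

Lemma dsum0 : dsum 0.
Proof.
split; last by move=> n; apply: piece_comp0.
apply: (sub_finite_set _ (@finite_set0 int)) => n /= /eqP; exact.
Qed.

Lemma dsumD f h : dsum f -> dsum h -> dsum (f + h).
Proof.
move=> [f1 f2] [h1 h2]; split; last by move=> n; apply: piece_compD.
have fhU : finite_set (classical_sets.setU [set n | f n != 0] [set n | h n != 0]).
  by rewrite finite_setU.
apply: (sub_finite_set _ fhU) => n /= /eqP fh.
case: (eqVneq (f n) 0) => [fn|]; [right|by left].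
by apply/eqP => hn; apply: fh; rewrite dprodD fn hn addr0.
Qed.

Lemma dsumZ c f : dsum f -> dsum (c *: f).
Proof.
move=> [f1 f2]; split; last by move=> n; apply: piece_compZ.
apply: (sub_finite_set _ f1) => n /= /eqP fn.
by apply/eqP => f0; apply: fn; rewrite dprodZ f0 scaler0.
Qed.

Lemma dsumN f : dsum f -> dsum (- f).
Proof. by rewrite -scaleN1r; apply: dsumZ. Qed.

Definition inj n (z : piece n) : P := dfwith (fun n => 0 : piece n) z.

Lemma injE n (z : piece n) : inj z n = z.
Proof. exact: dfwith_in. Qed.

Lemma injN n m (z : piece n) : n != m -> inj z m = 0.
Proof. by move=> nm; rewrite /inj dfwith_out. Qed.

Lemma injP n (z : piece n) (w : P) :
  w n = z -> (forall m, n != m -> w m = 0) -> inj z = w.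
Proof.
move=> wn wm; apply: dprodP => m; case: (eqVneq n m) => [<-|nm].
  by rewrite injE.
by rewrite injN // wm.
Qed.

Lemma inj_lin n : linear (@inj n).
Proof.
move=> c u v; apply: injP => [|m nm]; rewrite dprodD dprodZ.
  by rewrite !injE.
by rewrite !injN // scaler0 addr0.
Qed.

Lemma dsum_inj n (z : piece n) : piece_comp z -> dsum (inj z).
Proof.
move=> Cz; split=> [|m].
  apply: (sub_finite_set _ (finite_set1 n)) => m /= /eqP zm.
  by apply/esym/eqP; apply/negPn/negP => nm; apply: zm; rewrite injN.
case: (eqVneq n m) => [<-|nm]; first by rewrite injE.
by rewrite injN //; apply: piece_comp0.
Qed.

Lemma dsum_ind (Q : P -> Prop) : Q 0 ->
  (forall u v, dsum u -> dsum v -> Q u -> Q v -> Q (u + v)) ->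
  (forall n (z : piece n), piece_comp z -> Q (inj z)) ->
  forall w, dsum w -> Q w.
Proof.
move=> Q0 QD Qi w [/finite_seqP[s sE] Cw].
have {sE} : forall n, w n != 0 -> n \in s.
  by move=> n wn; have : [set n | w n != 0]%classic n by []; rewrite sE.
elim: s w Cw => [|m s IH] w Cw sE.
  rewrite (_ : w = 0) //; apply: dprodP => n; apply/eqP.
  by apply/negPn/negP => /sE.
pose v : P := w - inj (w m).
have vE n : v n = w n - inj (w m) n by [].
have Cv n : piece_comp (v n).
  rewrite vE; case: (eqVneq m n) => [<-|mn].
    by rewrite injE subrr; apply: piece_comp0.
  by rewrite injN // subr0.
have vs n : v n != 0 -> n \in s.
  rewrite vE; case: (eqVneq m n) => [<-|mn]; first by rewrite injE subrr eqxx.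
  by rewrite injN // subr0 => /sE; rewrite inE eq_sym (negPf mn).
have -> : w = inj (w m) + v by rewrite addrC subrK.
apply: QD => //; [exact: dsum_inj | | exact: Qi | exact: IH].
split=> //; apply: (@sub_finite_set _ _ [set` s]%classic) => //.
Qed.

Definition ip i (z : hp i) : P := @inj (Posz i) z.
Definition im i : hm i -> P :=
  match i return hm i -> P with
  | 0 => @ip 0
  | j.+1 => @inj (Negz j)
  end.

Lemma ip_lin i : linear (@ip i). Proof. exact: (@inj_lin (Posz i)). Qed.
Lemma im_lin i : linear (@im i). Proof. by case: i => [|i]; [exact: (@inj_lin (Posz 0)) | exact: (@inj_lin (Negz i))]. Qed.
Lemma dsum_ip i z : cp z -> dsum (@ip i z).
Proof. exact: (@dsum_inj (Posz i)). Qed.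
Lemma dsum_im i z : cm z -> dsum (@im i z).
Proof.
case: i z => [|i] z; first by move=> _; apply: (@dsum_inj (Posz 0)).
exact: (@dsum_inj (Negz i)).
Qed.

Lemma dsum_indpm (Q : P -> Prop) : Q 0 ->
  (forall u v, dsum u -> dsum v -> Q u -> Q v -> Q (u + v)) ->
  (forall i z, cp z -> Q (@ip i z)) -> (forall i z, cm z -> Q (@im i z)) ->
  forall w, dsum w -> Q w.
Proof.
move=> Q0 QD Qp Qm; apply: dsum_ind => // -[] i z Cz; first exact: Qp.
exact: (Qm i.+1).
Qed.

Lemma dsum_indmp (Q : P -> Prop) : Q 0 ->
  (forall u v, dsum u -> dsum v -> Q u -> Q v -> Q (u + v)) ->
  (forall i z, cm z -> Q (@im i z)) -> (forall i z, cp z -> Q (@ip i z)) ->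
  forall w, dsum w -> Q w.
Proof. by move=> Q0 QD Qp Qm; apply: dsum_indpm. Qed.

Let actp_lin := act_linr rB rArep.
Let actm_lin := act_linr rA rBrep.
Let evp_lin := ev_linl Phi_bil.
Let evm_lin := ev_linl Psi_bil.
Let pp_lin := pmap_linr rB rArep Phi_bil.
Let pm_lin := pmap_linr rA rBrep Psi_bil.

Lemma opD_lin a : linear (opD a).
Proof.
move=> c u v; apply: dprodP => -[] n; rewrite dprodD dprodZ;
  [exact: actp_lin | exact: actm_lin].
Qed.

Lemma opX_lin x : linear (opX x).
Proof.
move=> c u v; apply: dprodP => -[[|n]|n]; rewrite dprodD dprodZ.
- change (- @evm 0 (c *: u (Negz 0) + v (Negz 0)) x =
    c *: - @evm 0 (u (Negz 0)) x - @evm 0 (v (Negz 0)) x).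
  by rewrite (linD (evm_lin _)) (linZ (evm_lin _)) opprD scalerN.
- exact: pp_lin.
- change (- @evm n.+1 (c *: u (Negz n.+1) + v (Negz n.+1)) x =
    c *: - @evm n.+1 (u (Negz n.+1)) x - @evm n.+1 (v (Negz n.+1)) x).
  by rewrite (linD (evm_lin _)) (linZ (evm_lin _)) opprD scalerN.
Qed.

Lemma opY_lin y : linear (opY y).
Proof.
move=> c u v; apply: dprodP => -[n|[|n]]; rewrite dprodD dprodZ.
- change (- @evp n (c *: u (Posz n.+1) + v (Posz n.+1)) y =
    c *: - @evp n (u (Posz n.+1)) y - @evp n (v (Posz n.+1)) y).
  by rewrite (linD (evp_lin _)) (linZ (evp_lin _)) opprD scalerN.
- exact: pm_lin.
- exact: pm_lin.
Qed.

Lemma opD_linl w : dsum w -> linear (opD ^~ w).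
Proof.
move=> [_ Cw] c u v; apply: dprodP => -[] n; rewrite dprodD dprodZ.
  exact: (act_linl rArep rBrep Phi_bil Phi_equiv (Cw (Posz n))).
exact: (act_linl rBrep rArep Psi_bil Psi_equiv (Cw (Negz n))).
Qed.

Lemma opX_linl w : dsum w -> linear (opX ^~ w).
Proof.
move=> [_ Cw] c u v; apply: dprodP => -[[|n]|n]; rewrite dprodD dprodZ.
- have L := ev_linear rBrep rArep Psi_bil Psi_equiv (Cw (Negz 0)).
  change (- @evm 0 (w (Negz 0)) (c *: u + v) =
    c *: - @evm 0 (w (Negz 0)) u - @evm 0 (w (Negz 0)) v).
  by rewrite (linD L) (linZ L) opprD scalerN.
- exact: (pmap_linl rArep rBrep Phi_bil Phi_equiv (Cw (Posz n))).
- have L := ev_linear rBrep rArep Psi_bil Psi_equiv (Cw (Negz n.+1)).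
  change (- @evm n.+1 (w (Negz n.+1)) (c *: u + v) =
    c *: - @evm n.+1 (w (Negz n.+1)) u - @evm n.+1 (w (Negz n.+1)) v).
  by rewrite (linD L) (linZ L) opprD scalerN.
Qed.

Lemma opY_linl w : dsum w -> linear (opY ^~ w).
Proof.
move=> [_ Cw] c u v; apply: dprodP => -[n|[|n]]; rewrite dprodD dprodZ.
- have L := ev_linear rArep rBrep Phi_bil Phi_equiv (Cw (Posz n.+1)).
  change (- @evp n (w (Posz n.+1)) (c *: u + v) =
    c *: - @evp n (w (Posz n.+1)) u - @evp n (w (Posz n.+1)) v).
  by rewrite (linD L) (linZ L) opprD scalerN.
- exact: (@pmap_linl _ _ _ _ _ _ _ rBrep rArep Psi_bil Psi_equiv 0 _ (Cw (Posz 0))).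
- exact: (pmap_linl rBrep rArep Psi_bil Psi_equiv (Cw (Negz n))).
Qed.

Lemma opX_ip i x z : opX x (@ip i z) = @ip i.+1 (pp x z).
Proof.
apply/esym; apply: injP => [|[[|m]|m] nm].
- by change (pp x (@ip i z (Posz i)) = pp x z); rewrite /ip /im ?injE.
- change (- @evm 0 (@ip i z (Negz 0)) x = 0).
  by rewrite /ip /im ?injN // (lin0 (evm_lin _)) oppr0.
- change (pp x (@ip i z (Posz m)) = 0).
  by rewrite /ip /im ?injN // (lin0 (pp_lin _)).
- change (- @evm m.+1 (@ip i z (Negz m.+1)) x = 0).
  by rewrite /ip /im ?injN // (lin0 (evm_lin _)) oppr0.
Qed.

Lemma opX_im i x z : opX x (@im i.+1 z) = - @im i (evm z x).
Proof.
rewrite -(linN (@im_lin _)); apply/esym; case: i z => [|i] z.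
  apply: injP => [|[[|m]|m] nm].
  - by change (- @evm 0 (@im 1 z (Negz 0)) x = - evm z x); rewrite /ip /im ?injE.
  - by [].
  - change (pp x (@im 1 z (Posz m)) = 0).
    by rewrite /ip /im ?injN // (lin0 (pp_lin _)).
  - change (- @evm m.+1 (@im 1 z (Negz m.+1)) x = 0).
    by rewrite /ip /im ?injN // (lin0 (evm_lin _)) oppr0.
apply: injP => [|[[|m]|m] nm].
- by change (- @evm i.+1 (@im i.+2 z (Negz i.+1)) x = - evm z x); rewrite /ip /im ?injE.
- change (- @evm 0 (@im i.+2 z (Negz 0)) x = 0).
  by rewrite /ip /im ?injN // (lin0 (evm_lin _)) oppr0.
- change (pp x (@im i.+2 z (Posz m)) = 0).
  by rewrite /ip /im ?injN // (lin0 (pp_lin _)).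
- change (- @evm m.+1 (@im i.+2 z (Negz m.+1)) x = 0).
  by rewrite /ip /im ?injN // (lin0 (evm_lin _)) oppr0.
Qed.

Lemma opY_ip i y z : opY y (@ip i.+1 z) = - @ip i (evp z y).
Proof.
rewrite -(linN (@ip_lin _)); apply/esym; apply: injP => [|[m|[|m]] nm].
- by change (- @evp i (@ip i.+1 z (Posz i.+1)) y = - evp z y); rewrite /ip /im ?injE.
- change (- @evp m (@ip i.+1 z (Posz m.+1)) y = 0).
  by rewrite /ip /im ?injN // (lin0 (evp_lin _)) oppr0.
- change (@pm 0 y (@ip i.+1 z (Posz 0)) = 0).
  by rewrite /ip /im ?injN // (lin0 (@pm_lin 0 _)).
- change (pm y (@ip i.+1 z (Negz m)) = 0).
  by rewrite /ip /im ?injN // (lin0 (@pm_lin m.+1 _)).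
Qed.

Lemma opY_im i y z : opY y (@im i z) = @im i.+1 (pm y z).
Proof.
apply/esym; case: i z => [|i] z; apply: injP => [|[m|[|m]] nm].
- by change (@pm 0 y (@ip 0 z (Posz 0)) = pm y z); rewrite /ip /im ?injE.
- change (- @evp m (@ip 0 z (Posz m.+1)) y = 0).
  by rewrite /ip /im ?injN // (lin0 (evp_lin _)) oppr0.
- by [].
- change (@pm m.+1 y (@ip 0 z (Negz m)) = 0).
  by rewrite /ip /im ?injN // (lin0 (@pm_lin m.+1 _)).
- by change (pm y (@inj (Negz i) z (Negz i)) = pm y z); rewrite /ip /im ?injE.
- change (- @evp m (@inj (Negz i) z (Posz m.+1)) y = 0).
  by rewrite /ip /im ?injN // (lin0 (evp_lin _)) oppr0.
- change (@pm 0 y (@inj (Negz i) z (Posz 0)) = 0).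
  by rewrite /ip /im ?injN // (lin0 (@pm_lin 0 _)).
- change (@pm m.+1 y (@inj (Negz i) z (Negz m)) = 0).
  by rewrite /ip /im ?injN // (lin0 (@pm_lin m.+1 _)).
Qed.

Lemma opD_ip i a z : opD a (@ip i z) = @ip i (actp a z).
Proof.
apply/esym; apply: injP => [|[m|m] nm].
- by change (actp a (@ip i z (Posz i)) = actp a z); rewrite /ip /im ?injE.
- change (actp a (@ip i z (Posz m)) = 0).
  by rewrite /ip /im ?injN // (lin0 (actp_lin _)).
- change (actm a (@ip i z (Negz m)) = 0).
  by rewrite /ip /im ?injN // (lin0 (@actm_lin m.+1 _)).
Qed.

Lemma opD_im i a z : opD a (@im i z) = @im i (actm a z).
Proof.
case: i z => [|i] z; first exact: (@opD_ip 0).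
apply/esym; apply: injP => [|[m|m] nm].
- by change (actm a (@im i.+1 z (Negz i)) = actm a z); rewrite /ip /im ?injE.
- change (actp a (@im i.+1 z (Posz m)) = 0).
  by rewrite /ip /im ?injN // (lin0 (actp_lin _)).
- change (actm a (@im i.+1 z (Negz m)) = 0).
  by rewrite /ip /im ?injN // (lin0 (@actm_lin m.+1 _)).
Qed.

Lemma dsum_opD a w : dsum w -> dsum (opD a w).
Proof.
move: w; apply: dsum_indpm.
- by rewrite (lin0 (opD_lin _)); apply: dsum0.
- by move=> u v _ _ Tu Tv; rewrite (linD (opD_lin _)); apply: dsumD.
- by move=> i z Cz; rewrite opD_ip; apply/dsum_ip/comp_act.
- move=> i z Cz; rewrite opD_im; apply/dsum_im.
  exact: (comp_act rBrep rArep Psi_bil Psi_equiv).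
Qed.

Lemma dsum_opX x w : dsum w -> dsum (opX x w).
Proof.
move: w; apply: dsum_indpm.
- by rewrite (lin0 (opX_lin _)); apply: dsum0.
- by move=> u v _ _ Tu Tv; rewrite (linD (opX_lin _)); apply: dsumD.
- by move=> i z Cz; rewrite opX_ip; apply/dsum_ip/comp_pmap.
- move=> [|i] z Cz.
    rewrite [im z](_ : _ = @ip 0 z) // opX_ip; apply/dsum_ip/comp_pmap.
    by [].
  rewrite opX_im; apply/dsumN/dsum_im.
  exact: (comp_ev rBrep rArep Psi_bil Psi_equiv).
Qed.

Lemma dsum_opY y w : dsum w -> dsum (opY y w).
Proof.
move: w; apply: dsum_indpm.
- by rewrite (lin0 (opY_lin _)); apply: dsum0.
- by move=> u v _ _ Tu Tv; rewrite (linD (opY_lin _)); apply: dsumD.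
- move=> [|i] z Cz.
    rewrite [ip z](_ : _ = @im 0 z) // opY_im.
    by apply: (@dsum_im 1).
  rewrite opY_ip; apply/dsumN/dsum_ip.
  exact: (comp_ev rArep rBrep Phi_bil Phi_equiv).
- by move=> i z Cz; rewrite opY_im; apply/dsum_im/comp_pmap.
Qed.

Lemma opDX a x w : dsum w ->
  opD a (opX x w) = opX (rA a x) w + opX x (opD a w).
Proof.
move=> [_ Cw]; apply: dprodP => -[[|n]|n]; rewrite dprodD.
- change (@actm 0 a (- @evm 0 (w (Negz 0)) x) =
    - @evm 0 (w (Negz 0)) (rA a x) - @evm 0 (@actm 1 a (w (Negz 0))) x).
  by rewrite (linN (@actm_lin 0 _)) (ev_equiv Psi_equiv) opprD addrC.
- exact: (pmap_equiv rArep rBrep Phi_bil Phi_equiv _ _ (Cw (Posz n))).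
- change (actm a (- @evm n.+1 (w (Negz n.+1)) x) =
    - @evm n.+1 (w (Negz n.+1)) (rA a x) - @evm n.+1 (actm a (w (Negz n.+1))) x).
  by rewrite (linN (actm_lin _)) (ev_equiv Psi_equiv) opprD addrC.
Qed.

Lemma opDY a y w : dsum w ->
  opD a (opY y w) = opY (rB a y) w + opY y (opD a w).
Proof.
move=> [_ Cw]; apply: dprodP => -[n|[|n]]; rewrite dprodD.
- change (actp a (- @evp n (w (Posz n.+1)) y) =
    - @evp n (w (Posz n.+1)) (rB a y) - @evp n (actp a (w (Posz n.+1))) y).
  by rewrite (linN (actp_lin _)) (ev_equiv Phi_equiv) opprD addrC.
- exact: (@pmap_equiv _ _ _ _ _ _ _ rBrep rArep Psi_bil Psi_equiv 0 _ _ _ (Cw (Posz 0))).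
- exact: (pmap_equiv rBrep rArep Psi_bil Psi_equiv _ _ (Cw (Negz n))).
Qed.

Lemma opDD a b w : dsum w ->
  opD (lie a b) w = opD a (opD b w) - opD b (opD a w).
Proof.
move=> [_ Cw]; apply: dprodP => -[n|n]; rewrite dprodD.
  exact: (act_lie rArep rBrep Phi_bil Phi_equiv _ _ (Cw (Posz n))).
exact: (act_lie rBrep rArep Psi_bil Psi_equiv _ _ (Cw (Negz n))).
Qed.

Lemma opXY x y w : dsum w ->
  opX x (opY y w) = opY y (opX x w) + opD (Phi x y) w.
Proof.
move=> [_ Cw]; apply: dprodP => -[[|n]|[|n]]; rewrite dprodD.
- change (- Psi (- rB (w (Posz 0)) y) x =
    - Phi (- rA (w (Posz 0)) x) y + lie (Phi x y) (w (Posz 0))).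
  rewrite /Psi (bilNl Phi_bil) (bilNr Phi_bil) !opprK [lie _ _]lieC Phi_equiv.
  by rewrite opprD addrA subrr add0r.
- change (pp x (- evp (w (Posz n.+1)) y) =
    - (actp (Phi x y) (w (Posz n.+1)) + pp x (evp (w (Posz n.+1)) y))
    + actp (Phi x y) (w (Posz n.+1))).
  by rewrite (linN (pp_lin _)) opprD addrC addrA subrr add0r.
- change (- (@actm 1 (- Phi x y) (w (Negz 0)) + @pm 0 y (evm (w (Negz 0)) x)) =
    @pm 0 y (- evm (w (Negz 0)) x) + @actm 1 (Phi x y) (w (Negz 0))).
  have L := act_linl rBrep rArep Psi_bil Psi_equiv (Cw (Negz 0)).
  by rewrite (linN L) (linN (@pm_lin 0 _)) opprD opprK addrC.
- change (- (@actm n.+2 (- Phi x y) (w (Negz n.+1))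
      + @pm n.+1 y (evm (w (Negz n.+1)) x)) =
    @pm n.+1 y (- evm (w (Negz n.+1)) x) + @actm n.+2 (Phi x y) (w (Negz n.+1))).
  have L := act_linl rBrep rArep Psi_bil Psi_equiv (Cw (Negz n.+1)).
  by rewrite (linN L) (linN (@pm_lin n.+1 _)) opprD opprK addrC.
Qed.

Lemma opYX y x w : dsum w ->
  opY y (opX x w) = opX x (opY y w) + opD (Psi y x) w.
Proof.
by move=> Tw; rewrite opXY // /Psi (linN (opD_linl Tw)) addrK.
Qed.

Definition Fp m (w : P) : Prop :=
  (forall i, w (Negz i) = 0) /\ forall i, (i < m)%N -> w (Posz i) = 0.
Definition Fm m (w : P) : Prop :=
  [/\ forall i, w (Posz i.+1) = 0, (0 < m)%N -> w (Posz 0) = 0 &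
      forall i, (i.+1 < m)%N -> w (Negz i) = 0].

Lemma FpD m u v : Fp m u -> Fp m v -> Fp m (u + v).
Proof.
by move=> [u1 u2] [v1 v2]; split=> i *; rewrite dprodD ?u1 ?v1 ?u2 ?v2 ?addr0.
Qed.
Lemma FpN m u : Fp m u -> Fp m (- u).
Proof. by move=> [u1 u2]; split=> i *; rewrite dprodN ?u1 ?u2 ?oppr0. Qed.
Lemma Fp0 m : Fp m 0. Proof. by []. Qed.
Lemma FpS m u : Fp m.+1 u -> Fp m u.
Proof. by move=> [u1 u2]; split=> // i im'; apply/u2/ltnW. Qed.
Lemma Fp_ip m i z : (m <= i)%N -> Fp m (@ip i z).
Proof.
move=> mi; split=> j; first by rewrite /ip injN.
by move=> jm; rewrite /ip /im ?injN //; apply/eqP => -[ij]; rewrite ij leqNgt jm in mi.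
Qed.
Lemma Fp_opX m x u : Fp m u -> Fp m.+1 (opX x u).
Proof.
move=> [u1 u2]; split=> [i|[|i] im'].
- change (- @evm i.+1 (u (Negz i.+1)) x = 0).
  by rewrite u1 (lin0 (evm_lin _)) oppr0.
- change (- @evm 0 (u (Negz 0)) x = 0).
  by rewrite u1 (lin0 (evm_lin _)) oppr0.
- change (pp x (u (Posz i)) = 0).
  by rewrite u2 // (lin0 (pp_lin _)).
Qed.
Lemma Fp_trans u : Fp 2 u -> (forall y, opY y u = 0) -> u = 0.
Proof.
move=> [u1 u2] Yu; apply: dprodP => -[[|[|n]]|n]; [exact: u2..| |exact: u1].
apply/funext => y; have := congr1 (fun w : P => w (Posz n.+1)) (Yu y).
by move/eqP; rewrite oppr_eq0 => /eqP.
Qed.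

Lemma FmD m u v : Fm m u -> Fm m v -> Fm m (u + v).
Proof.
by move=> [u1 u2 u3] [v1 v2 v3]; split=> *;
  rewrite dprodD ?u1 ?v1 ?u2 ?v2 ?u3 ?v3 ?addr0.
Qed.
Lemma FmN m u : Fm m u -> Fm m (- u).
Proof.
by move=> [u1 u2 u3]; split=> *; rewrite dprodN ?u1 ?u2 ?u3 ?oppr0.
Qed.
Lemma Fm0 m : Fm m 0. Proof. by []. Qed.
Lemma FmS m u : Fm m.+1 u -> Fm m u.
Proof. by move=> [u1 u2 u3]; split=> // [_|i im']; [apply/u2 | apply/u3/ltnW]. Qed.
Lemma Fm_im m i z : (m <= i)%N -> Fm m (@im i z).
Proof.
case: i z => [|i] z mi.
  by rewrite leqn0 in mi; rewrite (eqP mi); split=> // j; rewrite /im /ip injN.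
split=> [j|_|j jm]; rewrite /ip /im ?injN //.
by apply/eqP => -[ij]; rewrite ij leqNgt jm in mi.
Qed.
Lemma Fm_opY m y u : Fm m u -> Fm m.+1 (opY y u).
Proof.
move=> [u1 u2 u3]; split=> [i|_|[|i] im'].
- change (- @evp i.+1 (u (Posz i.+2)) y = 0).
  by rewrite u1 (lin0 (evp_lin _)) oppr0.
- change (- @evp 0 (u (Posz 1)) y = 0).
  by rewrite u1 (lin0 (evp_lin _)) oppr0.
- change (@pm 0 y (u (Posz 0)) = 0).
  by rewrite u2 // (lin0 (@pm_lin 0 _)).
- change (@pm i.+1 y (u (Negz i)) = 0).
  by rewrite u3 // (lin0 (@pm_lin i.+1 _)).
Qed.
Lemma Fm_trans u : Fm 2 u -> (forall x, opX x u = 0) -> u = 0.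
Proof.
move=> [u1 u2 u3] Xu; apply: dprodP => -[[|n]|[|n]].
- exact: u2.
- exact: u1.
- exact: u3.
apply/funext => x; have := congr1 (fun w : P => w (Negz n)) (Xu x).
by move/eqP; rewrite oppr_eq0 => /eqP.
Qed.

Local Notation adp := (@ad k g A B rA rB Phi P opD opX).
Local Notation adm := (@ad k g B A rB rA Psi P opD opY).

Lemma adp_inv i : ad_inv rA rB Phi dsum opD opX opY ip im Fp i.
Proof.
apply: (@adP _ _ _ _ _ _ _ Psi) => //.
- exact: opD_lin.
- exact: opX_lin.
- exact: opY_lin.
- exact: opX_linl.
- exact: dsum_opX.
- exact: dsum0.
- exact: dsumD.
- exact: dsumN.
- exact: dsum_ip.
- exact: dsum_im.
- exact: dsum_indpm.
- exact: ip_lin.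
- exact: im_lin.
- exact: opX_ip.
- exact: opX_im.
- exact: opY_ip.
- exact: opY_im.
- exact: opDX.
- exact: opXY.
- exact: FpD.
- exact: FpN.
- exact: FpS.
- exact: Fp_ip.
- exact: Fp_opX.
- exact: Fp_trans.
Qed.

Lemma adm_inv i : ad_inv rB rA Psi dsum opD opY opX im ip Fm i.
Proof.
apply: (@adP _ _ _ _ _ _ _ Phi) => //.
- exact: Psi_bil.
- exact: Psi_equiv.
- by move=> x y; rewrite /Psi opprK.
- exact: opD_lin.
- exact: opY_lin.
- exact: opX_lin.
- exact: opY_linl.
- exact: dsum_opY.
- exact: dsum0.
- exact: dsumD.
- exact: dsumN.
- exact: dsum_im.
- exact: dsum_ip.
- exact: dsum_indmp.
- exact: im_lin.
- exact: ip_lin.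
- exact: opY_im.
- exact: opY_ip.
- exact: opX_im.
- exact: opX_ip.
- exact: opDY.
- exact: opYX.
- exact: FmD.
- exact: FmN.
- exact: FmS.
- exact: Fm_im.
- exact: Fm_opY.
- exact: Fm_trans.
Qed.

Lemma ad_piece_linl n c (u v : piece n) w :
  piece_comp u -> piece_comp v -> dsum w ->
  ad_piece (c *: u + v) w = c *: ad_piece u w + ad_piece v w.
Proof.
case: n u v => [[|n]|n] u v Cu Cv Tw.
- exact: (opD_linl Tw).
- exact: (ai_linl (adp_inv n)).
- exact: (ai_linl (adm_inv n)).
Qed.

Lemma ad_piece0 n w : dsum w -> @ad_piece n 0 w = 0.
Proof.
move=> Tw; have := ad_piece_linl 1 (piece_comp0 n) (piece_comp0 n) Tw.
rewrite !scale1r addr0 => /(congr1 (fun v => v - @ad_piece n 0 w)).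
by rewrite subrr addrK.
Qed.

Lemma ad_piece_lin n (u : piece n) : piece_comp u -> linear (ad_piece u).
Proof.
case: n u => [[|n]|n] u Cu.
- exact: opD_lin.
- exact: (ai_lin (adp_inv n)).
- exact: (ai_lin (adm_inv n)).
Qed.

Lemma dsum_ad_piece n (u : piece n) w :
  piece_comp u -> dsum w -> dsum (ad_piece u w).
Proof.
case: n u => [[|n]|n] u Cu Tw.
- exact: dsum_opD.
- exact: (ai_T (adp_inv n)).
- exact: (ai_T (adm_inv n)).
Qed.

Lemma bracketE f w s : dsum w -> uniq s -> (forall n, f n != 0 -> n \in s) ->
  bracket f w = \sum_(n <- s) ad_piece (f n) w.
Proof.
move=> Tw us fs; rewrite /bracket (fsbigE s) //.
  by apply: eq_bigl => n; rewrite in_setT.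
move=> n _ ns; suff -> : f n = 0 by apply: ad_piece0.
by apply/eqP; apply: contraR ns => /fs.
Qed.

Lemma dsum_supp f : dsum f ->
  exists2 s : seq int, uniq s & forall n, f n != 0 -> n \in s.
Proof.
move=> [/finite_seqP[s sE] _]; exists (undup s); first exact: undup_uniq.
move=> n fn; rewrite mem_undup.
by have : [set n | f n != 0]%classic n by []; rewrite sE.
Qed.

Lemma bracket_linl c f h w : dsum f -> dsum h -> dsum w ->
  bracket (c *: f + h) w = c *: bracket f w + bracket h w.
Proof.
move=> Tf Th Tw; have [s _ sf] := dsum_supp Tf; have [s' _ sh] := dsum_supp Th.
pose r := undup (s ++ s'); have ur : uniq r by apply: undup_uniq.
have rf n : f n != 0 -> n \in r by rewrite mem_undup mem_cat => /sf->.
have rh n : h n != 0 -> n \in r by rewrite mem_undup mem_cat orbC => /sh->.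
rewrite !(@bracketE _ w r) //; first last.
  move=> n; rewrite dprodD dprodZ; apply: contraR => nr.
  have /eqP -> : f n == 0 by apply: contraR nr => /rf.
  have /eqP -> : h n == 0 by apply: contraR nr => /rh.
  by rewrite scaler0 addr0.
rewrite scaler_sumr -big_split; apply: eq_bigr => n _.
by rewrite dprodD dprodZ ad_piece_linl //; [apply: Tf.2 | apply: Th.2].
Qed.

Lemma bracket_linr c f w w' : dsum f -> dsum w -> dsum w' ->
  bracket f (c *: w + w') = c *: bracket f w + bracket f w'.
Proof.
move=> Tf Tw Tw'; have [s us fs] := dsum_supp Tf.
rewrite !(@bracketE f _ s) //; last by apply: dsumD => //; apply: dsumZ.
rewrite scaler_sumr -big_split; apply: eq_bigr => n _.
have L := ad_piece_lin (Tf.2 n).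
by rewrite (linD L) (linZ L).
Qed.

Lemma dsum_bracket f w : dsum f -> dsum w -> dsum (bracket f w).
Proof.
move=> Tf Tw; have [s us fs] := dsum_supp Tf; rewrite (@bracketE f w s) //.
apply: big_ind => [||n _]; [exact: dsum0 | exact: dsumD |].
by apply: dsum_ad_piece => //; apply: Tf.2.
Qed.

Lemma bracket_inj n (z : piece n) w : dsum w -> bracket (inj z) w = ad_piece z w.
Proof.
move=> Tw; rewrite (@bracketE _ _ [:: n]) ?big_seq1 ?injE //.
move=> m; apply: contraR; rewrite inE => mn; rewrite injN //.
by rewrite eq_sym.
Qed.

Lemma bracket_ip i z w : dsum w -> bracket (@ip i z) w = adp z w.
Proof. by move=> Tw; rewrite /ip bracket_inj. Qed.

Lemma bracket_im i z w : dsum w -> bracket (@im i z) w = adm z w.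
Proof. by case: i z => [|i] z Tw; rewrite /im /ip bracket_inj. Qed.

Lemma bracketDl f h w : dsum f -> dsum h -> dsum w ->
  bracket (f + h) w = bracket f w + bracket h w.
Proof. by move=> *; rewrite -[f]scale1r bracket_linl // !scale1r. Qed.
Lemma bracketDr f w w' : dsum f -> dsum w -> dsum w' ->
  bracket f (w + w') = bracket f w + bracket f w'.
Proof. by move=> *; rewrite -[w]scale1r bracket_linr // !scale1r. Qed.
Lemma bracket0l w : dsum w -> bracket 0 w = 0.
Proof.
move=> Tw; rewrite (@bracketE _ _ [::]) ?big_nil // => n.
by rewrite eqxx.
Qed.
Lemma bracket0r f : dsum f -> bracket f 0 = 0.
Proof.
move=> Tf; have := bracketDr Tf dsum0 dsum0; rewrite addr0.
by move/(congr1 (fun v => v - bracket f 0)); rewrite subrr addrK.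
Qed.
Lemma bracketNl f w : dsum f -> dsum w -> bracket (- f) w = - bracket f w.
Proof.
move=> Tf Tw; rewrite -[- f]addr0 -scaleN1r bracket_linl //; last exact: dsum0.
by rewrite bracket0l // addr0 scaleN1r.
Qed.
Lemma bracketNr f w : dsum f -> dsum w -> bracket f (- w) = - bracket f w.
Proof.
move=> Tf Tw; rewrite -[- w]addr0 -scaleN1r bracket_linr //; last exact: dsum0.
by rewrite bracket0r // addr0 scaleN1r.
Qed.
Lemma bracketBr f w w' : dsum f -> dsum w -> dsum w' ->
  bracket f (w - w') = bracket f w - bracket f w'.
Proof. by move=> *; rewrite bracketDr ?bracketNr //; apply: dsumN. Qed.

Lemma dsum_sum (J : eqType) (s : seq J) (F : J -> P) :
  (forall t, t \in s -> dsum (F t)) -> dsum (\sum_(t <- s) F t).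
Proof.
by move=> Hs; rewrite big_seq; apply: big_ind => //; [apply: dsum0 | apply: dsumD].
Qed.

Let jac z := forall w v, dsum w -> dsum v ->
  bracket (bracket z w) v = bracket z (bracket w v) - bracket w (bracket z v).

Lemma jac_aux (M : zmodType) (a b c d e f : M) :
  a - b - (c - d) - (e - c - (b - f)) = a - e - (f - d).
Proof.
rewrite !opprD !opprK !addrA [LHS](ACl (1*5*8*4*(3*6)*(2*7)))%AC /=.
by rewrite !addNr !addr0.
Qed.

Lemma jac_bracket x z : dsum x -> dsum z -> jac x -> jac z -> jac (bracket x z).
Proof.
move=> Tx Tz Jx Jz w v Tw Tv.
have Tb := dsum_bracket; rewrite (Jx z w) // bracketDl //; [|by auto..|].
- rewrite bracketNl //; [|by auto..].
  rewrite (Jx (bracket z w)) //; [|by auto].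
  rewrite (Jz (bracket x w)) //; [|by auto].
  rewrite (Jz w v) // (Jx w v) // (Jx z (bracket w v)) //; [|by auto].
  rewrite (Jx z v) // (Jz w (bracket x v)) //; [|by auto].
  rewrite !bracketBr //; [|by auto..].
  rewrite (Jx w (bracket z v)) //; [|by auto].
  exact: jac_aux.
- by apply/dsumN; auto.
Qed.

Lemma jac0 : jac 0.
Proof.
move=> w v Tw Tv; rewrite !bracket0l ?bracket0r ?subrr //.
exact: dsum_bracket.
Qed.

Lemma jacD u v : dsum u -> dsum v -> jac u -> jac v -> jac (u + v).
Proof.
move=> Tu Tv Ju Jv w t Tw Tt; have Tb := dsum_bracket.
rewrite !(@bracketDl u v) //; [|by auto..].
rewrite (@bracketDl (bracket u w)) //; [|by auto..].
rewrite (@bracketDr w) //; [|by auto..].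
by rewrite Ju // Jv // opprD addrACA.
Qed.

Lemma jac_D a : jac (@ip 0 a).
Proof.
move=> w v Tw Tv; rewrite !(@bracket_ip 0) //; last exact: dsum_bracket.
change (bracket (opD a w) v = opD a (bracket w v) - bracket w (opD a v)).
have TDv := dsum_opD a Tv.
move: w Tw; apply: dsum_indpm.
- rewrite (lin0 (opD_lin a)) !bracket0l // (lin0 (opD_lin a)) subrr //.
- move=> u w Tu Tw Qu Qw; have TDu := dsum_opD a Tu; have TDw := dsum_opD a Tw.
  rewrite (linD (opD_lin a)) !bracketDl // Qu Qw (linD (opD_lin a)).
  by rewrite opprD addrACA.
- move=> i z Cz; rewrite opD_ip !bracket_ip //.
  case: i z Cz => [|i] z Cz; first exact: opDD.
  by rewrite (ai_D (adp_inv i)) // addrK.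
- move=> i z Cz; rewrite opD_im !bracket_im //.
  case: i z Cz => [|i] z Cz; first exact: opDD.
  by rewrite (ai_D (adm_inv i)) // addrK.
Qed.

Lemma jac_X x : jac (@ip 1 x).
Proof.
move=> w v Tw Tv; rewrite !(@bracket_ip 1) //; last exact: dsum_bracket.
change (bracket (opX x w) v = opX x (bracket w v) - bracket w (opX x v)).
have TXv := dsum_opX x Tv.
move: w Tw; apply: dsum_indpm.
- rewrite (lin0 (opX_lin x)) !bracket0l // (lin0 (opX_lin x)) subrr //.
- move=> u w Tu Tw Qu Qw; have TXu := dsum_opX x Tu; have TXw := dsum_opX x Tw.
  rewrite (linD (opX_lin x)) !bracketDl // Qu Qw (linD (opX_lin x)).
  by rewrite opprD addrACA.
- by move=> i z Cz; rewrite opX_ip !bracket_ip // (ai_p (adp_inv i)).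
- move=> [|i] z Cz.
    rewrite [im z](_ : _ = @ip 0 z) // opX_ip !bracket_ip //.
    exact: (ai_p (adp_inv 0)).
  rewrite opX_im bracketNl //; last first.
    by apply/dsum_im/comp_ev => //; [exact: Psi_bil | exact: Psi_equiv].
  rewrite !bracket_im // (ai_Y (adm_inv i)) //.
  by rewrite opprD addrA subrr add0r.
Qed.

Lemma jac_Y y : jac (@im 1 y).
Proof.
move=> w v Tw Tv; rewrite !(@bracket_im 1) //; last exact: dsum_bracket.
change (bracket (opY y w) v = opY y (bracket w v) - bracket w (opY y v)).
have TYv := dsum_opY y Tv.
move: w Tw; apply: dsum_indpm.
- rewrite (lin0 (opY_lin y)) !bracket0l // (lin0 (opY_lin y)) subrr //.
- move=> u w Tu Tw Qu Qw; have TYu := dsum_opY y Tu; have TYw := dsum_opY y Tw.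
  rewrite (linD (opY_lin y)) !bracketDl // Qu Qw (linD (opY_lin y)).
  by rewrite opprD addrACA.
- move=> [|i] z Cz.
    rewrite [ip z](_ : _ = @im 0 z) // opY_im !bracket_im //.
    exact: (ai_p (adm_inv 0)).
  rewrite opY_ip bracketNl //; last first.
    by apply/dsum_ip/comp_ev.
  rewrite !bracket_ip // (ai_Y (adp_inv i)) //.
  by rewrite opprD addrA subrr add0r.
- by move=> i z Cz; rewrite opY_im !bracket_im // (ai_p (adm_inv i)).
Qed.

Lemma ip_step i (Q : P -> Prop) (z : hp i.+2) : cp z -> Q 0 ->
  (forall u v, dsum u -> dsum v -> Q u -> Q v -> Q (u + v)) ->
  (forall x u, cp u -> Q (bracket (@ip 1 x) (@ip i.+1 u))) -> Q (ip z).
Proof.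
move=> [s Hs ->] Q0 QD Qb; rewrite (lin_sum (@ip_lin _)) big_seq.
set S := (\sum_(t <- s | _) _); suff : dsum S /\ Q S by case.
rewrite {}/S; apply: (big_ind (fun v => dsum v /\ Q v)) => [|u v [Tu Qu] [Tv Qv]|t /Hs[_ Ct]].
- by split=> //; apply: dsum0.
- by split; [apply: dsumD | apply: QD].
split; first exact/dsum_ip/comp_pmap.
rewrite -opX_ip; move: (Qb t.1 t.2 Ct); rewrite bracket_ip //.
exact: dsum_ip.
Qed.

Lemma im_step i (Q : P -> Prop) (z : hm i.+2) : cm z -> Q 0 ->
  (forall u v, dsum u -> dsum v -> Q u -> Q v -> Q (u + v)) ->
  (forall y u, cm u -> Q (bracket (@im 1 y) (@im i.+1 u))) -> Q (im z).
Proof.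
move=> [s Hs ->] Q0 QD Qb; rewrite (lin_sum (@im_lin _)) big_seq.
set S := (\sum_(t <- s | _) _); suff : dsum S /\ Q S by case.
rewrite {}/S; apply: (big_ind (fun v => dsum v /\ Q v)) => [|u v [Tu Qu] [Tv Qv]|t /Hs[_ Ct]].
- by split=> //; apply: dsum0.
- by split; [apply: dsumD | apply: QD].
split; first exact/dsum_im/comp_pmap.
rewrite -opY_im; move: (Qb t.1 t.2 Ct); rewrite bracket_im //.
exact: dsum_im.
Qed.

Lemma dsum_gen (Q : P -> Prop) : Q 0 ->
  (forall u v, dsum u -> dsum v -> Q u -> Q v -> Q (u + v)) ->
  (forall u v, dsum u -> dsum v -> Q u -> Q v -> Q (bracket u v)) ->
  (forall a, Q (@ip 0 a)) -> (forall x, Q (@ip 1 x)) -> (forall y, Q (@im 1 y)) ->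
  forall w, dsum w -> Q w.
Proof.
move=> Q0 QD Qb QG QX QY; apply: dsum_indpm => //.
- elim=> [|[|i] IH] z Cz //; apply: ip_step => // x u Cu; apply: Qb => //.
  + exact: (@dsum_ip 1).
  + exact: dsum_ip.
  + exact: IH.
- elim=> [|[|i] IH] z Cz //; first exact: QG.
  apply: im_step => // x u Cu; apply: Qb => //.
  + exact: (@dsum_im 1).
  + exact: dsum_im.
  + exact: IH.
Qed.

Lemma jacP z : dsum z -> jac z.
Proof.
apply: dsum_gen; [exact: jac0 | exact: jacD | exact: jac_bracket | exact: jac_D |
  exact: jac_X | exact: jac_Y].
Qed.

Let skew z := forall w, dsum w -> bracket z w = - bracket w z.

Lemma skew_bracket x z : dsum x -> dsum z -> skew x -> skew z -> skew (bracket x z).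
Proof.
move=> Tx Tz Sx Sz w Tw; have Tb := dsum_bracket.
have E := jacP Tw Tx Tz.
have -> : bracket w (bracket x z) =
    bracket (bracket w x) z + bracket x (bracket w z) by rewrite E subrK.
have -> : bracket (bracket w x) z = - bracket z (bracket w x).
  by rewrite (Sz (bracket w x)) ?opprK //; auto.
rewrite jacP // (Sz w Tw) (Sx w Tw) !bracketNr //; [|by auto..].
by rewrite opprK opprD opprK addrC.
Qed.

Lemma skew_D a : skew (@ip 0 a).
Proof.
apply: dsum_indpm.
- by rewrite bracket0l ?bracket0r ?oppr0 //; apply: (@dsum_ip 0).
- move=> u v Tu Tv Qu Qv; have Ta : dsum (@ip 0 a) by apply: (@dsum_ip 0).
  by rewrite bracketDr // bracketDl // Qu Qv opprD.
- move=> i z Cz; rewrite !bracket_ip; [|exact: (@dsum_ip 0) | exact: dsum_ip].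
  rewrite [LHS]opD_ip; case: i z Cz => [|i] z Cz.
    by rewrite [X in - X]opD_ip -(linN (@ip_lin _)) !act0 -lieC.
  by rewrite (ai_G (adp_inv i)) // opprK.
- move=> i z Cz; rewrite bracket_im; last exact: (@dsum_ip 0).
  rewrite bracket_ip; last exact: dsum_im.
  rewrite [LHS]opD_im; case: i z Cz => [|i] z Cz.
    by rewrite [X in - X](@opD_im 0) -(linN (@im_lin 0)) !act0 -lieC.
  by rewrite [X in - X](ai_G (adm_inv i)) // opprK.
Qed.

Lemma skew_X x : skew (@ip 1 x).
Proof.
have Tx : dsum (@ip 1 x) by apply: (@dsum_ip 1).
have E i z : cp z -> bracket (@ip 1 x) (@ip i z) = - bracket (ip z) (@ip 1 x).
  move=> Cz; rewrite !bracket_ip //; last exact: dsum_ip.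
  rewrite [LHS]opX_ip; case: i z Cz => [|i] z Cz.
    by rewrite [X in - X]opD_ip pmap0 (linN (@ip_lin _)).
  by rewrite (ai_X (adp_inv i)) // opprK.
apply: dsum_indpm => //.
- by rewrite bracket0l ?bracket0r ?oppr0.
- by move=> u v Tu Tv Qu Qv; rewrite bracketDr // bracketDl // Qu Qv opprD.
- move=> [|i] z Cz; first exact: (E 0).
  rewrite bracket_ip; last exact: dsum_im.
  by rewrite [LHS]opX_im bracket_im // (ai_N (adm_inv i)).
Qed.

Lemma skew_Y y : skew (@im 1 y).
Proof.
have Ty : dsum (@im 1 y) by apply: (@dsum_im 1).
have E i z : cm z -> bracket (@im 1 y) (@im i z) = - bracket (im z) (@im 1 y).
  move=> Cz; rewrite !bracket_im //; last exact: dsum_im.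
  rewrite [LHS]opY_im; case: i z Cz => [|i] z Cz.
    by rewrite [X in - X](@opD_im 1) pmap0 (linN (@im_lin _)).
  by rewrite (ai_X (adm_inv i)) // opprK.
apply: dsum_indmp => //.
- by rewrite bracket0l ?bracket0r ?oppr0.
- by move=> u v Tu Tv Qu Qv; rewrite bracketDr // bracketDl // Qu Qv opprD.
- move=> [|i] z Cz; first exact: (E 0).
  rewrite bracket_im; last exact: dsum_ip.
  by rewrite [LHS]opY_ip bracket_ip // (ai_N (adp_inv i)).
Qed.

Lemma skewP z : dsum z -> skew z.
Proof.
apply: dsum_gen.
- by move=> w Tw; rewrite bracket0l ?bracket0r ?oppr0.
- move=> u v Tu Tv Su Sv w Tw.
  by rewrite bracketDr // bracketDl // Su // Sv // opprD.
- exact: skew_bracket.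
- exact: skew_D.
- exact: skew_X.
- exact: skew_Y.
Qed.

Lemma bracket_sq0 x z : dsum x -> dsum z -> bracket x (bracket z z) = 0.
Proof.
move=> Tx Tz; have Tb := dsum_bracket Tx Tz.
have E := jacP Tx Tz Tz.
have -> : bracket x (bracket z z) =
    bracket (bracket x z) z + bracket z (bracket x z) by rewrite E subrK.
by rewrite (skewP Tb) // addNr.
Qed.

Lemma bracketxx z : dsum z -> bracket z z = 0.
Proof.
move: z; apply: dsum_indpm.
- by rewrite bracket0l //; apply: dsum0.
- move=> u v Tu Tv Qu Qv; have Tuv := dsumD Tu Tv.
  rewrite bracketDl // !bracketDr // Qu Qv add0r addr0.
  by rewrite (skewP Tu) // addNr.
- move=> i z Cz; have Tz := dsum_ip Cz.
  case: i z Cz Tz => [|i] z Cz Tz.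
    by rewrite bracket_ip // [LHS]opD_ip act0 liexx (lin0 (@ip_lin _)).
  apply: Fp_trans => [|y].
    by rewrite bracket_ip //; apply: (ai_F (adp_inv i)) => //; apply: Fp_ip.
  have Ty : dsum (@im 1 y) by apply: (@dsum_im 1).
  by have := bracket_sq0 Ty Tz; rewrite bracket_im //; apply: dsum_bracket.
- move=> i z Cz; have Tz := dsum_im Cz.
  case: i z Cz Tz => [|i] z Cz Tz.
    by rewrite bracket_im // [LHS](@opD_im 0) act0 liexx (lin0 (@im_lin _)).
  apply: Fm_trans => [|x].
    by rewrite bracket_im //; apply: (ai_F (adm_inv i)) => //; apply: Fm_im.
  have Tx : dsum (@ip 1 x) by apply: (@dsum_ip 1).
  by have := bracket_sq0 Tx Tz; rewrite bracket_ip //; apply: dsum_bracket.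
Qed.

Lemma bracket_jacobi x y z : dsum x -> dsum y -> dsum z ->
  bracket x (bracket y z) + bracket y (bracket z x) + bracket z (bracket x y) = 0.
Proof.
move=> Tx Ty Tz; have Tb := dsum_bracket.
rewrite (skewP Tz (w := bracket x y)); last by auto.
rewrite jacP // (skewP Tz) // bracketNr //; last by auto.
by rewrite subrr.
Qed.

Definition dsum_submod : submod P := Submod dsum0 dsumD dsumZ.

(* The proofs of the hypotheses are parameters of this type because its Lie
   algebra structure depends on them. *)
Definition assoc_sum : Type := submod_type dsum_submod.

HB.instance Definition _ := GRing.Lmodule.on assoc_sum.

Definition assoc_bracket (f h : assoc_sum) : assoc_sum :=
  in_submod (S := dsum_submod)
    (dsum_bracket (submod_valP f) (submod_valP h)).

Fact assoc_bracket_bilinear : is_bilinear assoc_bracket.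
Proof.
split=> f c u v; apply: val_inj.
  exact: (bracket_linl _ (submod_valP u) (submod_valP v) (submod_valP f)).
exact: (bracket_linr _ (submod_valP f) (submod_valP u) (submod_valP v)).
Qed.

Fact assoc_bracketxx f : assoc_bracket f f = 0.
Proof. by apply: val_inj; exact: (bracketxx (submod_valP f)). Qed.

Fact assoc_bracket_jacobi f h e :
  assoc_bracket f (assoc_bracket h e) + assoc_bracket h (assoc_bracket e f)
    + assoc_bracket e (assoc_bracket f h) = 0.
Proof.
by apply: val_inj;
  exact: (bracket_jacobi (submod_valP f) (submod_valP h) (submod_valP e)).
Qed.

HB.instance Definition _ := Lmodule_isLieAlgebra.Build k assoc_sum
  assoc_bracket_bilinear assoc_bracketxx assoc_bracket_jacobi.

Definition assoc_lie : lieAlgType k := assoc_sum.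

(* The defining rules of the bracket, with V_i and V_{-i} embedded in the direct
   sum by [ip] and [im]. *)
Lemma bracket_a_ip a i z : cp z -> bracket (@ip 0 a) (@ip i z) = ip (actp a z).
Proof. by move=> Cz; rewrite bracket_ip ?[LHS]opD_ip //; apply: dsum_ip. Qed.

Lemma bracket_a_im a i z : cm z -> bracket (@ip 0 a) (@im i z) = im (actm a z).
Proof. by move=> Cz; rewrite bracket_ip ?[LHS]opD_im //; apply: dsum_im. Qed.

Lemma bracket_x_ip x i z : cp z -> bracket (@ip 1 x) (@ip i z) = ip (pp x z).
Proof. by move=> Cz; rewrite bracket_ip ?[LHS]opX_ip //; apply: dsum_ip. Qed.

Lemma bracket_x_im x i z :
  cm z -> bracket (@ip 1 x) (@im i.+1 z) = - im (evm z x).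
Proof. by move=> Cz; rewrite bracket_ip ?[LHS]opX_im //; apply: dsum_im. Qed.

Lemma bracket_y_ip y i z :
  cp z -> bracket (@im 1 y) (@ip i.+1 z) = - ip (evp z y).
Proof. by move=> Cz; rewrite bracket_im ?[LHS]opY_ip //; apply: dsum_ip. Qed.

Lemma bracket_y_im y i z : cm z -> bracket (@im 1 y) (@im i z) = im (pm y z).
Proof. by move=> Cz; rewrite bracket_im ?[LHS]opY_im //; apply: dsum_im. Qed.

Lemma bracket_pp x i z w : @cp i z -> dsum w ->
  bracket (ip (pp x z)) w =
  bracket (@ip 1 x) (bracket (ip z) w) - bracket (ip z) (bracket (@ip 1 x) w).
Proof.
move=> Cz Tw; rewrite -bracket_x_ip //.
by apply: jacP => //; [apply: (@dsum_ip 1) | apply: dsum_ip].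
Qed.

Lemma bracket_pm y i z w : @cm i z -> dsum w ->
  bracket (im (pm y z)) w =
  bracket (@im 1 y) (bracket (im z) w) - bracket (im z) (bracket (@im 1 y) w).
Proof.
move=> Cz Tw; rewrite -bracket_y_im //.
by apply: jacP => //; [apply: (@dsum_im 1) | apply: dsum_im].
Qed.

End Associated.

(* The data of a pentad (g, rho, V, VV, B0), VV being a subspace of the space of
   all functions V -> k; [std_dual_linear] puts it inside Hom(V, k). *)
Record pentad (k : fieldType) := Pentad {
  pen_g : lieAlgType k;
  pen_V : lmodType k;
  pen_rho : pen_g -> pen_V -> pen_V;
  pen_dual : submod (pen_V -> k^o : lmodType k);
  pen_form : pen_g -> pen_g -> k^o }.

Record is_standard (k : fieldType) (p : pentad k) : Prop := IsStandard {
  std_neq0 : exists a : pen_g p, a != 0;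
  std_form_bilinear : is_bilinear (@pen_form k p);
  std_form_nondegenerate : is_nondegenerate (@pen_form k p);
  std_form_invariant : forall a b c : pen_g p,
    pen_form (lie a b) c = pen_form a (lie b c);
  std_rho : is_representation (@pen_rho k p);
  std_dual_linear : forall phi, pen_dual p phi -> linear phi;
  std_dual_stable : forall a phi, pen_dual p phi ->
    pen_dual p (fun v => - phi (pen_rho a v));
  std_pairing : is_nondegenerate
    (fun (v : pen_V p) (phi : submod_type (pen_dual p)) => val phi v);
  std_Phi : exists2 Phi : pen_V p -> submod_type (pen_dual p) -> pen_g p,
    is_bilinear Phi &
    forall a v phi, pen_form a (Phi v phi) = val phi (pen_rho a v) }.

Section StandardPentad.
Variables (k : fieldType) (p : pentad k) (Hp : is_standard p).

Local Notation g := (pen_g p).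
Local Notation V := (pen_V p).
Local Notation VV := (submod_type (pen_dual p)).

Definition pen_corho (a : g) (phi : VV) : VV :=
  in_submod (std_dual_stable Hp a (submod_valP phi)).

Definition pen_Phi : V -> VV -> g := s2val (cid2 (std_Phi Hp)).

Lemma pen_Phi_bilinear : is_bilinear pen_Phi.
Proof. exact: (s2valP (cid2 (std_Phi Hp))). Qed.

Lemma pen_PhiE a v phi : pen_form a (pen_Phi v phi) = val phi (pen_rho a v).
Proof. exact: (s2valP' (cid2 (std_Phi Hp))). Qed.

Lemma pen_corho_rep : is_representation pen_corho.
Proof.
have [rb rl] := std_rho Hp; split; first split.
- move=> phi c a b; apply: val_inj; apply/funext => v /=.
  have L := std_dual_linear Hp (submod_valP phi).
  change (- val phi (pen_rho (c *: a + b) v) =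
    c *: - val phi (pen_rho a v) - val phi (pen_rho b v)).
  by rewrite rb.1 (linD L) (linZ L) opprD scalerN.
- move=> a c phi psi; apply: val_inj; apply/funext => v /=.
  change (- (c *: val phi (pen_rho a v) + val psi (pen_rho a v)) =
    c *: - val phi (pen_rho a v) - val psi (pen_rho a v)).
  by rewrite opprD scalerN.
- move=> a b phi; apply: val_inj; apply/funext => v /=.
  have L := std_dual_linear Hp (submod_valP phi).
  change (- val phi (pen_rho (lie a b) v) =
    - - val phi (pen_rho b (pen_rho a v)) - - - val phi (pen_rho a (pen_rho b v))).
  by rewrite rl (linB L) !opprK opprB addrC.
Qed.

Lemma pen_Phi_equiv a v phi :
  lie a (pen_Phi v phi) =
  pen_Phi (pen_rho a v) phi + pen_Phi v (pen_corho a phi).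
Proof.
have [rb rl] := std_rho Hp.
apply/eqP; rewrite -subr_eq0; apply/eqP/(std_form_nondegenerate Hp).2 => b.
have L := std_dual_linear Hp (submod_valP phi).
rewrite (bilBr (std_form_bilinear Hp)) (bilDr (std_form_bilinear Hp)).
rewrite -(std_form_invariant Hp) !pen_PhiE rl (linB L).
change (val phi (pen_rho b (pen_rho a v)) - val phi (pen_rho a (pen_rho b v)) -
  (val phi (pen_rho b (pen_rho a v)) - val phi (pen_rho a (pen_rho b v))) = 0).
by rewrite subrr.
Qed.

(* L(g, rho, V, VV, B0) *)
Definition pentad_lie : lieAlgType k :=
  assoc_lie (std_rho Hp) pen_corho_rep pen_Phi_bilinear pen_Phi_equiv.

End StandardPentad.

Record gradedLieAlg (k : fieldType) := GradedLieAlg {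
  gl_lie :> lieAlgType k;
  gl : int -> submod gl_lie;
  gl_bracket : forall m n x y, gl m x -> gl n y -> gl (m + n) (lie x y);
  gl_span : forall x : gl_lie, exists (s : seq int) (f : int -> gl_lie),
    (forall n, gl n (f n)) /\ x = \sum_(n <- s) f n;
  gl_direct : forall (s : seq int) (f : int -> gl_lie), uniq s ->
    (forall n, gl n (f n)) -> \sum_(n <- s) f n = 0 ->
    forall n, n \in s -> f n = 0;
  gl_generated : forall S : submod gl_lie,
    (forall x y, S x -> S y -> S (lie x y)) ->
    (forall x, gl (-1) x -> S x) -> (forall x, gl 0 x -> S x) ->
    (forall x, gl 1 x -> S x) -> forall x, S x }.

Section GradedPentad.
Variables (k : fieldType) (L : gradedLieAlg k).

Definition piece0 : Type := submod_type (gl L 0).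
HB.instance Definition _ := GRing.Lmodule.on piece0.

Definition lie0 (a b : piece0) : piece0 :=
  in_submod (gl_bracket (submod_valP a) (submod_valP b) : gl L 0 _).

Fact lie0_bilinear : is_bilinear lie0.
Proof.
by split=> a c x y; apply: val_inj; [apply: lie_bilinear.1 | apply: lie_bilinear.2].
Qed.
Fact lie0xx a : lie0 a a = 0.
Proof. by apply: val_inj; apply: liexx. Qed.
Fact lie0_jacobi a b c :
  lie0 a (lie0 b c) + lie0 b (lie0 c a) + lie0 c (lie0 a b) = 0.
Proof. by apply: val_inj; apply: lie_jacobi. Qed.

HB.instance Definition _ :=
  Lmodule_isLieAlgebra.Build k piece0 lie0_bilinear lie0xx lie0_jacobi.

Definition ad1 (a : piece0) (x : submod_type (gl L 1)) : submod_type (gl L 1) :=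
  in_submod (gl_bracket (submod_valP a) (submod_valP x) : gl L 1 _).

Variables (B : L -> L -> k^o) (B_bilinear : is_bilinear B).

(* L_{-1}, as a subspace of the dual of L_1 *)
Definition form_dual (phi : submod_type (gl L 1) -> k^o) : Prop :=
  exists y : submod_type (gl L (-1)), phi = fun x => B (val x) (val y).

Fact form_dual0 : form_dual 0.
Proof. by exists 0; apply/funext => x /=; rewrite (bil0r B_bilinear). Qed.
Fact form_dualD phi psi : form_dual phi -> form_dual psi -> form_dual (phi + psi).
Proof.
move=> [y ->] [z ->]; exists (y + z); apply/funext => x /=.
by rewrite (bilDr B_bilinear).
Qed.
Fact form_dualZ c phi : form_dual phi -> form_dual (c *: phi).
Proof.
move=> [y ->]; exists (c *: y); apply/funext => x /=.
by rewrite (bilZr B_bilinear).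
Qed.

Definition graded_pentad : pentad k := {|
  pen_g := piece0;
  pen_V := submod_type (gl L 1);
  pen_rho := ad1;
  pen_dual := Submod form_dual0 form_dualD form_dualZ;
  pen_form := fun a b => B (val a) (val b) |}.

End GradedPentad.

Definition lie_isomorphic (k : fieldType) (L M : lieAlgType k) : Prop :=
  exists f : L -> M,
    [/\ linear f, bijective f & forall x y, f (lie x y) = lie (f x) (f y)].

(* Main.v *)
(** An element z of L is recorded by its iterated brackets with L_{-1}: put
    F_0(z), F_1(z) equal to the components of z in L_0, L_1, and
    F_{i+2}(z) = (y |-> F_{i+1}([z, y])).  The Jacobi identity turns the recursive
    formulas for rho_i and p_i into the brackets with L_0 and L_1, so F_i maps
    L_i = [L_1, L_{i-1}] onto V_i; invariance and non-degeneracy of B make it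
    injective on L_i.  Exchanging L_1 and L_{-1} gives the negative half.  The
    resulting linear bijection respects brackets with L_{-1}, L_0, L_1, hence all
    brackets, because L is generated by these. *)
Require Import Defs.
From HB Require Import structures.
From mathcomp Require Import all_boot all_order all_algebra.
From mathcomp Require Import boolp classical_sets functions cardinality fsbigop.

Set Implicit Arguments.
Unset Strict Implicit.
Unset Printing Implicit Defensive.

Import GRing.Theory.
Local Open Scope ring_scope.

(** * Homogeneous components in a graded Lie algebra *)

Section Components.
Variables (k : fieldType) (L : gradedLieAlg k).
Implicit Types (z : L) (f : int -> L).

(** The list [s] only has to contain the support of [f]. Decompositions with different lists can
    then be added over a common one, and uniqueness concerns [f] alone. *)
Definition decomposes f z : Prop :=
  (forall n, gl L n (f n)) /\
  exists s : seq int, [/\ uniq s, forall n, n \notin s -> f n = 0 &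
    z = \sum_(n <- s) f n].

Lemma sum_supp f (s r : seq int) : uniq s -> uniq r -> {subset s <= r} ->
  (forall n, n \notin s -> f n = 0) -> \sum_(n <- s) f n = \sum_(n <- r) f n.
Proof.
move=> us ur sr f0; rewrite (bigID (mem s) predT (r := r)) /=.
rewrite [X in _ + X]big1 // addr0 -[RHS]big_filter.
apply: perm_big; apply: uniq_perm => //; first exact: filter_uniq.
by move=> n; rewrite mem_filter andb_idr //; apply: sr.
Qed.

Lemma decomposes_lin c f f' z z' : decomposes f z -> decomposes f' z' ->
  decomposes (fun n => c *: f n + f' n) (c *: z + z').
Proof.
move=> [Gf [s [us sf ->]]] [Gf' [s' [us' sf' ->]]]; split=> [n|].
  by apply: submodD => //; apply: submodZ.
pose r := undup (s ++ s'); have ur : uniq r by apply: undup_uniq.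
exists r; split=> //.
  move=> n; rewrite mem_undup mem_cat negb_or => /andP[/sf-> /sf'->].
  by rewrite scaler0 addr0.
rewrite (sum_supp us ur) // 1?(sum_supp us' ur) // ?big_split ?scaler_sumr //.
  by move=> n ns; rewrite mem_undup mem_cat ns orbT.
by move=> n ns; rewrite mem_undup mem_cat ns.
Qed.

Lemma decomposes_homog n z :
  gl L n z -> decomposes (fun m => if m == n then z else 0) z.
Proof.
move=> Gz; split=> [m|]; first by case: eqP => [->|_] //; apply: submod0.
exists [:: n]; split=> //; last by rewrite big_seq1 eqxx.
by move=> m; rewrite inE => /negPf->.
Qed.

Lemma decomposes_uniq f f' z :
  decomposes f z -> decomposes f' z -> f = f'.
Proof.
(* The difference of the two families decomposes 0, so directness of the sum annihilates each of its
   terms. *)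
move=> df df'; have := decomposes_lin (- 1) df df'.
rewrite scaleN1r addNr => -[Gh [s [us sh /esym h0]]].
apply/funext => n; have : - 1 *: f n + f' n = 0.
  by case: (boolP (n \in s)) => [ns|/sh//]; apply: (gl_direct us Gh h0 ns).
by rewrite scaleN1r addrC => /eqP; rewrite subr_eq0 => /eqP.
Qed.

Lemma decomposes_ex z : exists f, decomposes f z.
Proof.
have [s [f [Gf ->]]] := gl_span z.
elim: s => [|n s [h dh]].
  exists (fun=> 0); rewrite big_nil; split=> [n|]; first exact: submod0.
  by exists [::]; rewrite big_nil.
rewrite big_cons -[f n]scale1r; eexists.
exact: (decomposes_lin 1 (decomposes_homog (Gf n)) dh).
Qed.

Definition component z : int -> L := projT1 (cid (decomposes_ex z)).

Lemma componentP z : decomposes (component z) z.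
Proof. exact: projT2 (cid (decomposes_ex z)). Qed.

Lemma component_homog n z m :
  gl L n z -> component z m = if m == n then z else 0.
Proof.
by move=> /decomposes_homog dz; rewrite (decomposes_uniq (componentP z) dz).
Qed.

Lemma component_eq0 z : (forall n, component z n = 0) -> z = 0.
Proof.
by move=> z0; have [_ [s [_ _ ->]]] := componentP z; rewrite big1.
Qed.

Lemma homog_ind (Q : L -> Prop) : Q 0 ->
  (forall u v, Q u -> Q v -> Q (u + v)) ->
  (forall n z, gl L n z -> Q z) -> forall z, Q z.
Proof.
move=> Q0 QD QG z; have [Gz [s [_ _ ->]]] := componentP z.
by apply: big_ind => // n _; apply: QG.
Qed.

Definition proj n z : submod_type (gl L n) :=
  in_submod ((componentP z).1 n).

Lemma proj_lin n : linear (proj n).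
Proof.
move=> c u v; apply: val_inj => /=.
by rewrite (decomposes_uniq (componentP _)
  (decomposes_lin c (componentP u) (componentP v))).
Qed.

Lemma proj_homog n z : gl L n z -> val (proj n z) = z.
Proof. by move=> Gz /=; rewrite (component_homog _ Gz) eqxx. Qed.

Lemma proj_val n (x : submod_type (gl L n)) : proj n (val x) = x.
Proof. by apply: val_inj; apply: proj_homog; apply: submod_valP. Qed.

Lemma proj_neq m n z : gl L m z -> m != n -> proj n z = 0.
Proof.
move=> Gz mn; apply: val_inj => /=.
by rewrite (component_homog _ Gz) eq_sym (negPf mn).
Qed.

End Components.

(* Stated abstractly because it is applied twice, with L_1 and L_{-1} exchanged
   and the grading reversed.  The maps j embed g, A, B as L_0, L_1, L_{-1}, and the
   maps q project L onto the first two. *)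
Record tower_iso (k : fieldType) (L : lieAlgType k) (G : int -> submod L)
    (g : lieAlgType k) (A B : lmodType k) (rA : g -> A -> A) (rB : g -> B -> B)
    (Phi : A -> B -> g) (j0 : g -> L) (jA : A -> L) (jB : B -> L)
    (F : forall i, L -> Defs.hom g A B i) : Prop := TowerIso {
  ti_lin : forall i, linear (F i);
  ti_neq : forall i n z, G n z -> n != i%:Z -> F i z = 0;
  ti_act : forall i a z, F i (lie (j0 a) z) = Defs.act rA rB a (F i z);
  ti_ev : forall i y z, F i (lie z (jB y)) = ev Phi (F i.+1 z) y;
  ti_pmap : forall i x z, F i.+1 (lie (jA x) z) = Defs.pmap rA rB Phi x (F i z);
  ti_comp : forall i z, Vcomp rA rB Phi (F i z);
  ti_onto : forall i u, Vcomp rA rB Phi u -> exists2 z, G i%:Z z & F i z = u;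
  ti_inj : forall i z, G i%:Z z -> F i z = 0 -> z = 0 }.

(** * The map from a graded Lie algebra onto one half of the tower *)

Section TowerMap.
Variables (k : fieldType) (L : lieAlgType k) (G : int -> submod L).
Variables (g : lieAlgType k) (A B : lmodType k).
Variables (rA : g -> A -> A) (rB : g -> B -> B) (Phi : A -> B -> g).
Variables (j0 : g -> L) (jA : A -> L) (jB : B -> L) (q0 : L -> g) (qA : L -> A).
Variable B0 : L -> L -> k^o.

Hypotheses (G_lie : forall m n x y, G m x -> G n y -> G (m + n) (lie x y))
  (G_ind : forall Q : L -> Prop, Q 0 ->
    (forall u v, Q u -> Q v -> Q (u + v)) ->
    (forall n z, G n z -> Q z) -> forall z, Q z).
Hypotheses (Gj0 : forall a, G 0 (j0 a)) (GjA : forall x, G 1 (jA x))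
  (GjB : forall y, G (-1) (jB y)) (jB_onto : forall z, G (-1) z -> exists y, jB y = z).
Hypotheses (q0_lin : linear q0) (qA_lin : linear qA)
  (j0K : cancel j0 q0) (jAK : cancel jA qA)
  (q0K : forall z, G 0 z -> j0 (q0 z) = z) (qAK : forall z, G 1 z -> jA (qA z) = z)
  (q0_neq : forall n z, G n z -> n != 0 -> q0 z = 0)
  (qA_neq : forall n z, G n z -> n != 1 -> qA z = 0).
Hypotheses (rA_bilinear : is_bilinear rA) (Phi_bilinear : is_bilinear Phi)
  (j0_0 : j0 0 = 0) (jA_0 : jA 0 = 0).
Hypotheses (lieE : forall a b, j0 (lie a b) = lie (j0 a) (j0 b))
  (rAE : forall a x, jA (rA a x) = lie (j0 a) (jA x))
  (rBE : forall a y, jB (rB a y) = lie (j0 a) (jB y))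
  (PhiE : forall x y, j0 (Phi x y) = lie (jA x) (jB y)).

Local Notation hp := (Defs.hom g A B).

(** The bracket is taken as [z, y], with y on the right, to match u(y) = [u, y] in the associated
    algebra. *)
Fixpoint tmap (i : nat) : L -> hp i :=
  match i return L -> hp i with
  | 0 => q0
  | i'.+1 =>
    match i' return (L -> hp i') -> L -> hp i'.+1 with
    | 0 => fun _ => qA
    | _.+1 => fun F z y => F (lie z (jB y))
    end (@tmap i')
  end.
Arguments tmap : simpl never.

Lemma tmapSS i z y : tmap i.+2 z y = tmap i.+1 (lie z (jB y)).
Proof. by []. Qed.

Lemma tmap_lin i : linear (tmap i).
Proof.
elim: i => [|[|i] IH] //.
move=> c u v; apply/funext => y; rewrite homD homZ !tmapSS.
by rewrite (bilDl lie_bilinear) (bilZl lie_bilinear) IH.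
Qed.

(** Each bracket with L_{-1} lowers both the degree and the index by one, down to the projections
    [q0] and [qA]. *)
Lemma tmap_neq i n z : G n z -> n != i%:Z -> tmap i z = 0.
Proof.
elim: i n z => [|[|i] IH] n z Gz ni; [exact: q0_neq ni | exact: qA_neq ni |].
apply/funext => y; rewrite tmapSS; apply: (IH (n + -1)); first exact: G_lie.
by apply: contra ni => /eqP E; rewrite intS -E addrC subrK.
Qed.

(** This and the next three lemmas are the base cases of the inductions below. They are checked on
    homogeneous z: in the one degree that contributes, z lies in the image of [j0] or [jA]; in all
    others both sides vanish. *)
Lemma tmap0_lie a z : q0 (lie (j0 a) z) = lie a (q0 z).
Proof.
move: z; apply: G_ind => [|u v Eu Ev|n z Gz].
- by rewrite (bil0r lie_bilinear) (lin0 q0_lin) (bil0r lie_bilinear).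
- by rewrite !(bilDr lie_bilinear) !(linD q0_lin) Eu Ev (bilDr lie_bilinear).
have Gaz := G_lie (Gj0 a) Gz; rewrite add0r in Gaz.
case: (eqVneq n 0) => n0; last first.
  by rewrite (q0_neq Gaz) // (q0_neq Gz) // (bil0r lie_bilinear).
by rewrite n0 in Gz; rewrite -[in LHS](q0K Gz) -lieE j0K.
Qed.

Lemma tmap1_lie a z : qA (lie (j0 a) z) = rA a (qA z).
Proof.
move: z; apply: G_ind => [|u v Eu Ev|n z Gz].
- by rewrite (bil0r lie_bilinear) (lin0 qA_lin) (bil0r rA_bilinear).
- by rewrite !(bilDr lie_bilinear) !(linD qA_lin) Eu Ev (bilDr rA_bilinear).
have Gaz := G_lie (Gj0 a) Gz; rewrite add0r in Gaz.
case: (eqVneq n 1) => n1; last first.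
  by rewrite (qA_neq Gaz) // (qA_neq Gz) // (bil0r rA_bilinear).
by rewrite n1 in Gz; rewrite -[in LHS](qAK Gz) -rAE jAK.
Qed.

Lemma tmap0_ev y z : q0 (lie z (jB y)) = Phi (qA z) y.
Proof.
move: z; apply: G_ind => [|u v Eu Ev|n z Gz].
- by rewrite (bil0l lie_bilinear) (lin0 q0_lin) (lin0 qA_lin) (bil0l Phi_bilinear).
- rewrite (bilDl lie_bilinear) (linD q0_lin) (linD qA_lin) Eu Ev.
  by rewrite (bilDl Phi_bilinear).
have Gzy := G_lie Gz (GjB y).
case: (eqVneq n 1) => n1; last first.
  rewrite (q0_neq Gzy) ?(qA_neq Gz) // ?(bil0l Phi_bilinear) //.
  by rewrite subr_eq0.
by rewrite n1 in Gz; rewrite -[in LHS](qAK Gz) -PhiE j0K.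
Qed.

Lemma tmap0_pmap x z : qA (lie (jA x) z) = - rA (q0 z) x.
Proof.
move: z; apply: G_ind => [|u v Eu Ev|n z Gz].
- rewrite (bil0r lie_bilinear) (lin0 q0_lin) (lin0 qA_lin) (bil0l rA_bilinear).
  by rewrite oppr0.
- rewrite (bilDr lie_bilinear) (linD q0_lin) (linD qA_lin) Eu Ev.
  by rewrite (bilDl rA_bilinear) opprD.
have Gxz := G_lie (GjA x) Gz.
case: (eqVneq n 0) => n0; last first.
  rewrite (qA_neq Gxz) ?(q0_neq Gz) // ?(bil0l rA_bilinear) ?oppr0 //.
  by rewrite -subr_eq0 addrC addKr.
rewrite n0 in Gz; rewrite -[in LHS](q0K Gz) lieC -rAE (linN qA_lin).
by rewrite jAK.
Qed.

(** The recursion defining [act] is the Jacobi identity [[a, z], y] = [a, [z, y]] - [z, [a, y]]. *)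
Lemma tmap_act i a z : tmap i (lie (j0 a) z) = Defs.act rA rB a (tmap i z).
Proof.
elim: i z => [|[|i] IH] z; [exact: tmap0_lie | exact: tmap1_lie |].
apply/funext => y.
by rewrite actS !tmapSS -IH rBE -(linB (@tmap_lin _)) lie_act.
Qed.

Lemma tmap_ev i y z : tmap i (lie z (jB y)) = ev Phi (tmap i.+1 z) y.
Proof. by case: i => [|i] //; apply: tmap0_ev. Qed.

(** The recursion defining [pmap] is the Jacobi identity [[x, z], y] = [[x, y], z] + [x, [z, y]],
    where [x, y] is [Phi x y]. *)
Lemma tmap_pmap i x z : tmap i.+1 (lie (jA x) z) = Defs.pmap rA rB Phi x (tmap i z).
Proof.
elim: i z => [|i IH] z; first exact: tmap0_pmap.
apply/funext => y; rewrite tmapSS pmapS -tmap_ev -IH -tmap_act PhiE.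
by rewrite -(linD (@tmap_lin _)) [lie (lie _ (jB y)) z]lieC addrC lie_act.
Qed.

Hypothesis G_pos : forall i z, G i.+2%:Z z -> tensor_image lie (G 1) (G i.+1%:Z) z.

(** Only the part of z in degree i matters, and for i at least 2 it is a sum of brackets with L_1,
    which go to values of [pmap]. *)
Lemma tmap_comp i z : Vcomp rA rB Phi (tmap i z).
Proof.
elim: i z => [|[|i] IH] // z.
move: z; apply: G_ind => [|u v Cu Cv|n z Gz].
- by rewrite (lin0 (@tmap_lin _)); apply: comp0.
- by rewrite (linD (@tmap_lin _)); apply: compD.
case: (eqVneq n i.+2%:Z) => ni; last first.
  by rewrite (tmap_neq Gz ni); apply: comp0.
rewrite ni in Gz; have [s Hs ->] := G_pos Gz.
rewrite (lin_sum (@tmap_lin _)); apply: comp_sum => t /Hs[G1 _].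
by rewrite -(qAK G1) tmap_pmap; apply: comp_pmap.
Qed.

Lemma tmap_onto i u : Vcomp rA rB Phi u -> exists2 z, G i%:Z z & tmap i z = u.
Proof.
elim: i u => [|[|i] IH] u.
- by move=> _; exists (j0 u); [exact: Gj0 | exact: j0K].
- by move=> _; exists (jA u); [exact: GjA | exact: jAK].
move=> [s Hs ->].
elim: s Hs => [|[x v] s IHs] Hs.
  exists 0; first exact: submod0.
  by rewrite big_nil (lin0 (@tmap_lin _)).
have [|z Gz zE] := IHs.
  by move=> t ts; apply: Hs; rewrite inE ts orbT.
have [_ /IH[w Gw wE]] := Hs (x, v) (mem_head _ _).
(* A preimage of p(x, v) is [x, w], where w is a preimage of v of one degree less. *)
exists (lie (jA x) w + z).
  by apply: submodD => //; rewrite intS; apply: G_lie.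
by rewrite (linD (@tmap_lin _)) zE big_cons tmap_pmap wE.
Qed.

Hypotheses (B0_bilinear : is_bilinear B0)
  (B0_invariant : forall x y z : L, B0 (lie x y) z = B0 x (lie y z))
  (B0_pieces : forall i z, G i%:Z z -> (forall w, G (- i%:Z) w -> B0 z w = 0) -> z = 0)
  (G_neg : forall i z,
     G (- i.+2%:Z) z -> tensor_image lie (G (-1)) (G (- i.+1%:Z)) z).

(* An element z of L_i with i >= 2 that commutes with L_{-1} is orthogonal to
   [L_{-1}, L_{1-i}] = L_{-i}, hence zero. *)
Lemma tmap_inj i z : G i%:Z z -> tmap i z = 0 -> z = 0.
Proof.
elim: i z => [|[|i] IH] z Gz zE.
- by rewrite -(q0K Gz) [q0 z]zE j0_0.
- by rewrite -(qAK Gz) [qA z]zE jA_0.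
have commz y : G (-1) y -> lie z y = 0.
  move=> /jB_onto[b <-]; apply: IH; last by rewrite -tmapSS zE.
  have := G_lie Gz (GjB b).
  by rewrite intS addrC addKr.
apply: (B0_pieces Gz) => w /G_neg[s Hs ->].
rewrite (bil_sumr B0_bilinear) big_seq big1 // => t /Hs[/commz zt _].
by rewrite -B0_invariant zt (bil0l B0_bilinear).
Qed.

Lemma tmapP : tower_iso G rA rB Phi j0 jA jB tmap.
Proof.
split; [exact: tmap_lin | exact: tmap_neq | exact: tmap_act | exact: tmap_ev |
  exact: tmap_pmap | exact: tmap_comp | exact: tmap_onto | exact: tmap_inj].
Qed.

End TowerMap.

Section Isomorphism.
Variables (k : fieldType) (L : gradedLieAlg k).
Hypothesis L0_neq0 : exists x : L, gl L 0 x /\ x != 0.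
Variables (B : L -> L -> k^o) (B_bilinear : is_bilinear B).
Hypotheses (B_symmetric : forall x y : L, B x y = B y x)
  (B_invariant : forall x y z : L, B (lie x y) z = B x (lie y z))
  (L_pos : forall i z, gl L i.+2%:Z z -> tensor_image lie (gl L 1) (gl L i.+1%:Z) z)
  (L_neg : forall i z,
     gl L (- i.+2%:Z) z -> tensor_image lie (gl L (-1)) (gl L (- i.+1%:Z)) z)
  (B_pos : forall i z,
     gl L i%:Z z -> (forall w, gl L (- i%:Z) w -> B z w = 0) -> z = 0)
  (B_neg : forall i z,
     gl L (- i%:Z) z -> (forall w, gl L i%:Z w -> B w z = 0) -> z = 0).

(** * L_{-1} as a space of functionals on L_1, and standardness of the pentad *)

Local Notation L1 := (submod_type (gl L 1)).
Local Notation Lm1 := (submod_type (gl L (-1))).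
Local Notation pent := (graded_pentad B_bilinear).
Local Notation VV := (submod_type (pen_dual pent)).

Definition to_dual (y : Lm1) : VV :=
  in_submod (S := pen_dual pent) (ex_intro _ y erefl).

Definition of_dual (phi : VV) : Lm1 := projT1 (cid (submod_valP phi)).

Lemma of_dualE (phi : VV) (x : L1) : B (val x) (val (of_dual phi)) = val phi x.
Proof. by rewrite [in RHS](projT2 (cid (submod_valP phi))). Qed.

Lemma of_dualK : cancel of_dual to_dual.
Proof. by move=> phi; apply: val_inj; apply/funext => x; apply: of_dualE. Qed.

Lemma to_dual_lin : linear to_dual.
Proof.
move=> c u v; apply: val_inj; apply/funext => x.
by rewrite [LHS]/= (bilDr B_bilinear) (bilZr B_bilinear).
Qed.

(** The representative chosen by [of_dual] differs from y by an element of L_{-1} orthogonal to L_1,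
    which is 0 by non-degeneracy. *)
Lemma to_dualK : cancel to_dual of_dual.
Proof.
move=> y; apply/eqP; rewrite -subr_eq0; apply/eqP; apply: val_inj.
apply: (B_neg (i := 1)) => [|w Gw]; first exact: submod_valP.
rewrite [val _]/= (bilBr B_bilinear).
by rewrite (of_dualE (to_dual y) (in_submod Gw)) subrr.
Qed.

Lemma of_dual_lin : linear of_dual.
Proof.
by move=> c u v; apply: (can_inj to_dualK); rewrite to_dual_lin !of_dualK.
Qed.

(** This is the map Phi of the pentad: if phi = B(-, y), invariance gives B(a, [x, y]) = B([a, x],
    y) = phi([a, x]). *)
Definition bracket_pm (x : L1) (phi : VV) : piece0 L :=
  in_submod (gl_bracket (submod_valP x) (submod_valP (of_dual phi)) : gl L 0 _).

Lemma graded_pentad_standard : is_standard pent.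
Proof.
split.
- by have [x [Gx x0]] := L0_neq0; exists (in_submod Gx).
- by split=> a c u v; [apply: B_bilinear.1 | apply: B_bilinear.2].
- split=> a a0; apply: val_inj.
    by apply: (B_pos (i := 0)) => [|w Gw];
      [apply: submod_valP | apply: (a0 (in_submod Gw))].
  by apply: (B_neg (i := 0)) => [|w Gw];
      [apply: submod_valP | apply: (a0 (in_submod Gw))].
- by move=> a b c; apply: B_invariant.
- split; first split.
  + by move=> v c a b; apply: val_inj; apply: lie_bilinear.1.
  + by move=> a c u v; apply: val_inj; apply: lie_bilinear.2.
  + by move=> a b v; apply: val_inj; apply: lie_act.
- by move=> phi [y ->] c u v; apply: B_bilinear.1.
- move=> a phi [y ->].
  (* Since -B([a, x], y) = B(x, [a, y]), the canonical action on functionals is the adjoint action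
     on L_{-1}. *)
  exists (in_submod (gl_bracket (submod_valP a) (submod_valP y) : gl L (-1) _)).
  apply/funext => x /=.
  by rewrite -B_invariant lieC (bilNl B_bilinear) opprK.
- split=> [x x0|phi phi0]; apply: val_inj.
    apply: (B_pos (i := 1)) => [|w Gw]; first exact: submod_valP.
    exact: (x0 (to_dual (in_submod Gw))).
  by apply/funext => x; apply: phi0.
- exists bracket_pm; first split.
  + by move=> phi c u v; apply: val_inj; apply: lie_bilinear.1.
  + move=> x c u v; apply: val_inj.
    by rewrite [LHS]/= of_dual_lin; apply: lie_bilinear.2.
  + by move=> a x phi; rewrite -of_dualE; apply/esym/B_invariant.
Qed.

(** * The two halves of the tower of the pentad *)

Variable std : is_standard pent.

Local Notation Phi := (pen_Phi std).
Local Notation rA := (@pen_rho k pent).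
Local Notation rB := (pen_corho std).

(** [pen_Phi] is obtained by choice from an arbitrary proof of standardness; non-degeneracy of the
    form on L_0 forces it to be [bracket_pm]. *)
Lemma val_pen_Phi x phi : val (Phi x phi) = lie (val x) (val (of_dual phi)).
Proof.
change (val (Phi x phi) = val (bracket_pm x phi)); congr val.
apply/eqP; rewrite -subr_eq0; apply/eqP/(std_form_nondegenerate std).2 => a.
rewrite (bilBr (std_form_bilinear std)) pen_PhiE -of_dualE.
by apply/eqP; rewrite subr_eq0; apply/eqP/B_invariant.
Qed.

Lemma val_pen_corho a phi :
  val (of_dual (rB a phi)) = lie (val a) (val (of_dual phi)).
Proof.
rewrite -[RHS]/(val (in_submod (gl_bracket (submod_valP a)
  (submod_valP (of_dual phi)) : gl L (-1) _))).
congr val; apply: (can_inj to_dualK); rewrite of_dualK.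
apply: val_inj; apply/funext => x.
rewrite [LHS]/= -(of_dualE phi) [RHS]/=.
by rewrite -B_invariant lieC (bilNl B_bilinear).
Qed.

Definition Fpos : forall i, L -> Defs.hom (piece0 L) L1 VV i :=
  @tmap k L (piece0 L) _ _ (fun phi => val (of_dual phi)) (@proj k L 0) (@proj k L 1).

Definition Fneg : forall i, L -> Defs.hom (piece0 L) VV L1 i :=
  @tmap k L (piece0 L) _ _ (fun x : L1 => val x) (@proj k L 0)
    (fun z => to_dual (proj (-1) z)).

Lemma Fpos_iso :
  tower_iso (gl L) rA rB Phi val val (fun phi => val (of_dual phi)) Fpos.
Proof.
rewrite /Fpos; apply: (tmapP (B0 := B)) => //.
- exact: gl_bracket.
- exact: homog_ind.
- by move=> a; apply: submod_valP.
- by move=> a; apply: submod_valP.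
- by move=> a; apply: submod_valP.
- by move=> z Gz; exists (to_dual (in_submod Gz)); rewrite to_dualK.
- exact: proj_lin.
- exact: proj_lin.
- exact: proj_val.
- exact: proj_val.
- exact: proj_homog.
- exact: proj_homog.
- by move=> n z Gz n0; apply: (proj_neq Gz).
- by move=> n z Gz n0; apply: (proj_neq Gz).
- exact: (std_rho std).1.
- exact: pen_Phi_bilinear.
- exact: val_pen_corho.
- exact: val_pen_Phi.
Qed.

(** With the grading reversed, VV plays the part of degree 1 and L_1 that of degree -1. The sign in
    [flip_Phi] is that of [y, x] = -[x, y]. *)
Lemma Fneg_iso :
  tower_iso (fun n => gl L (- n)) rB rA (flip_Phi Phi) val
    (fun phi => val (of_dual phi)) val Fneg.
Proof.
rewrite /Fneg; apply: (tmapP (B0 := B)) => //.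
- by move=> m n x y Gx Gy; rewrite opprD; apply: gl_bracket.
- move=> Q Q0 QD QG; apply: homog_ind => // n z Gz.
  by apply: (QG (- n)); rewrite opprK.
- by move=> a; apply: submod_valP.
- by move=> a; apply: submod_valP.
- by move=> a; rewrite opprK; apply: submod_valP.
- by move=> z; rewrite opprK => Gz; exists (in_submod Gz).
- exact: proj_lin.
- by move=> c u v; rewrite proj_lin to_dual_lin.
- exact: proj_val.
- by move=> phi; rewrite proj_val of_dualK.
- by move=> z Gz; apply: proj_homog.
- by move=> z Gz; rewrite to_dualK; apply: proj_homog.
- by move=> n z Gz n0; apply: (proj_neq Gz); rewrite oppr_eq0.
- move=> n z Gz n0; rewrite (proj_neq Gz) ?(lin0 to_dual_lin) //.
  by rewrite eqr_opp.
- exact: (pen_corho_rep std).1.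
- exact: (Psi_bil (pen_Phi_bilinear std)).
- by rewrite (lin0 of_dual_lin).
- exact: val_pen_corho.
- by move=> phi x; rewrite /flip_Phi [LHS]/= val_pen_Phi -lieC.
(* Here z has degree -i in L but stands on the left of B, so symmetry is needed to apply
   non-degeneracy on the other side. *)
- move=> i z Gz zw; apply: (B_neg Gz) => w Gw.
  by rewrite B_symmetric; apply: zw; rewrite opprK.
Qed.

(** * Gluing the two halves into a linear bijection onto the direct sum *)

Local Notation dsumL := (@dsum k (piece0 L) L1 VV rA rB Phi).
Local Notation ipL := (@ip k (piece0 L) L1 VV).
Local Notation imL := (@im k (piece0 L) L1 VV).

(* [Fpos] and [Fneg] vanish outside their own degree, so no projection of z onto
   its components is needed here. *)
Definition tower_image (z : L) : dprod (Defs.piece (piece0 L) L1 VV) := fun n =>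
  match n return Defs.piece (piece0 L) L1 VV n with
  | Posz i => Fpos i z
  | Negz i => Fneg i.+1 z
  end.

Lemma tower_image_lin : linear tower_image.
Proof.
move=> c u v; apply: dprodP => -[] n; rewrite dprodD dprodZ.
  exact: (ti_lin Fpos_iso).
exact: (ti_lin Fneg_iso).
Qed.

Lemma tower_image_neq m n z : gl L m z -> m != n -> tower_image z n = 0.
Proof.
case: n => n Gz mn; first exact: (ti_neq Fpos_iso Gz).
apply: (ti_neq Fneg_iso (n := - m)); first by rewrite opprK.
by apply: contra mn => /eqP E; rewrite NegzE -E opprK.
Qed.

Lemma tower_image_pos i z : gl L i%:Z z -> tower_image z = ipL (Fpos i z).
Proof.
move=> Gz; apply/esym; apply: injP => // m im.
exact: (tower_image_neq Gz).
Qed.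

Lemma tower_image_neg i z : gl L (- i%:Z) z -> tower_image z = imL (Fneg i z).
Proof.
case: i => [|i] Gz; first exact: (@tower_image_pos 0).
apply/esym; apply: injP => // m im.
by apply: (tower_image_neq Gz); rewrite -NegzE.
Qed.

Lemma tower_image_dsum z : dsumL (tower_image z).
Proof.
move: z; apply: homog_ind => [|u v Du Dv|[] i z Gz].
- by rewrite (lin0 tower_image_lin); apply: dsum0.
- by rewrite (linD tower_image_lin); apply: dsumD.
- by rewrite (tower_image_pos Gz); apply/dsum_ip/(ti_comp Fpos_iso).
rewrite NegzE in Gz.
by rewrite (tower_image_neg Gz); apply/dsum_im/(ti_comp Fneg_iso).
Qed.

Lemma tower_image_proj n z : tower_image (val (proj n z)) n = tower_image z n.
Proof.
move: z; apply: homog_ind => [|u v Eu Ev|m z Gz].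
- by rewrite (lin0 (@proj_lin _ _ n)).
- rewrite (linD (@proj_lin _ _ n)) (linD tower_image_lin u v) dprodD -Eu -Ev.
  by rewrite -dprodD -(linD tower_image_lin).
case: (eqVneq m n) => [<-|mn]; first by rewrite proj_homog.
by rewrite (proj_neq Gz mn) (tower_image_neq Gz mn) (lin0 tower_image_lin).
Qed.

(** Entry n of the image depends only on the component of z in L_n, on which the corresponding tower
    map is injective. *)
Lemma tower_image_inj z : tower_image z = 0 -> z = 0.
Proof.
move=> z0; apply: component_eq0 => n.
have := tower_image_proj n z; rewrite z0 dprod0.
case: n => i; first exact: (ti_inj Fpos_iso (submod_valP (proj i%:Z z))).
apply: (ti_inj Fneg_iso (i := i.+1)); rewrite -NegzE.
exact: (submod_valP (proj (Negz i) z)).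
Qed.

Lemma tower_image_onto w : dsumL w -> exists z, tower_image z = w.
Proof.
move: w; apply: dsum_ind => [|u v _ _ [x <-] [y <-]|[] i u Cu].
- by exists 0; rewrite (lin0 tower_image_lin).
- by exists (x + y); rewrite (linD tower_image_lin).
- have [z Gz <-] := ti_onto Fpos_iso Cu.
  by exists z; apply: tower_image_pos.
- have [z Gz <-] := ti_onto Fneg_iso Cu.
  by exists z; apply: (@tower_image_neg i.+1).
Qed.

(** * Compatibility with brackets *)

Lemma tower_image_opD a z :
  opD rA rB a (tower_image z) = tower_image (lie (val a) z).
Proof.
apply: dprodP => -[] i; apply/esym.
  exact: (ti_act Fpos_iso).
exact: (ti_act Fneg_iso i.+1).
Qed.

Lemma tower_image_opX x z :
  opX rA rB Phi x (tower_image z) = tower_image (lie (val x) z).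
Proof.
(* In degrees at most 0, [opX] is minus an evaluation, which matches -[z, x]; in positive degrees it
   is [pmap] and the swap is undone. *)
rewrite [in RHS]lieC (linN tower_image_lin).
apply: dprodP => -[[|i]|i]; rewrite dprodN.
- by congr (- _); apply/esym/(ti_ev Fneg_iso 0).
- have := ti_pmap Fpos_iso i x z.
  by rewrite lieC (linN (@ti_lin _ _ _ _ _ _ _ _ _ _ _ _ _ Fpos_iso i.+1)).
- by congr (- _); apply/esym/(ti_ev Fneg_iso i.+1).
Qed.

Lemma tower_image_opY y z :
  opY rA rB Phi y (tower_image z) = tower_image (lie (val (of_dual y)) z).
Proof.
apply: dprodP => -[i|[|i]].
- rewrite lieC (linN tower_image_lin) dprodN.
  by congr (- _); apply/esym/(ti_ev Fpos_iso i).
- exact/esym/(ti_pmap Fneg_iso 0).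
- exact/esym/(ti_pmap Fneg_iso i.+1).
Qed.

Definition to_assoc (z : L) : pentad_lie std :=
  in_submod (S := dsum_submod (std_rho std) (pen_corho_rep std)
    (pen_Phi_bilinear std) (pen_Phi_equiv std)) (tower_image_dsum z).

Lemma to_assoc_lin : linear to_assoc.
Proof. by move=> c u v; apply: val_inj; apply: tower_image_lin. Qed.

(** The elements x whose brackets with all of L are respected form a subalgebra [S]. It contains
    L_{-1}, L_0 and L_1, hence is all of L. *)
Lemma to_assoc_lie x y : to_assoc (lie x y) = lie (to_assoc x) (to_assoc y).
Proof.
pose S x := forall y, to_assoc (lie x y) = lie (to_assoc x) (to_assoc y).
have SE u v :
    bracket rA rB Phi (tower_image u) (tower_image v) = tower_image (lie u v) ->
    to_assoc (lie u v) = lie (to_assoc u) (to_assoc v).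
  by move=> E; apply: val_inj; apply/esym.
have S0 : S 0.
  by move=> z; rewrite (bil0l lie_bilinear) (lin0 to_assoc_lin) (bil0l lie_bilinear).
have SD u v : S u -> S v -> S (u + v).
  move=> Su Sv z; rewrite (bilDl lie_bilinear) !(linD to_assoc_lin) Su Sv.
  by rewrite (bilDl lie_bilinear).
have SZ c u : S u -> S (c *: u).
  move=> Su z; rewrite (bilZl lie_bilinear) !(linZ to_assoc_lin) Su.
  by rewrite (bilZl lie_bilinear).
have [rArep rBrep] := (std_rho std, pen_corho_rep std).
have [Pbil Pequiv] := (pen_Phi_bilinear std, pen_Phi_equiv std).
move: x y; apply: (gl_generated (S := Submod S0 SD SZ)) =>
  [u v Su Sv z|x Gx w|x Gx w|x Gx w].
(* In both algebras ad [u, v] is the commutator of ad u and ad v. *)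
- by rewrite Su !lie_act (linB to_assoc_lin) Su Sv Sv Su.
- apply: SE.
  (* For x of degree -1, 0 or 1 the image sits in a single degree, where the bracket is [opY], [opD]
     or [opX] by definition. *)
  rewrite (@tower_image_neg 1) // bracket_im //; last exact: tower_image_dsum.
  by rewrite [LHS]tower_image_opY to_dualK proj_homog.
- apply: SE.
  rewrite (@tower_image_pos 0) // bracket_ip //; last exact: tower_image_dsum.
  by rewrite [LHS]tower_image_opD proj_homog.
- apply: SE.
  rewrite (@tower_image_pos 1) // bracket_ip //; last exact: tower_image_dsum.
  by rewrite [LHS]tower_image_opX proj_homog.
Qed.

Lemma graded_lie_isomorphic : lie_isomorphic L (pentad_lie std).
Proof.
exists to_assoc; split; [exact: to_assoc_lin | | exact: to_assoc_lie].
have onto (w : pentad_lie std) : exists z, to_assoc z = w.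
  have [z zE] := tower_image_onto (submod_valP w).
  by exists z; apply: (@val_inj _ _ (submod_type _)).
exists (fun w => projT1 (cid (onto w))) => [z|w]; last exact: projT2 (cid (onto w)).
have /(congr1 (fun v => v - to_assoc z)) := projT2 (cid (onto (to_assoc z))).
rewrite subrr -(linB to_assoc_lin) => /(congr1 val)/tower_image_inj/eqP.
by rewrite subr_eq0 => /eqP.
Qed.

End Isomorphism.

Theorem theorem2p20 (k : fieldType) (L : gradedLieAlg k)
  (L0_neq0 : exists x : L, gl L 0 x /\ x != 0)
  (B : L -> L -> k^o)
  (B_bilinear : is_bilinear B)
  (B_nondegenerate : is_nondegenerate B)
  (B_symmetric : forall x y : L, B x y = B y x)
  (B_invariant : forall x y z : L, B (lie x y) z = B x (lie y z))
  (L_pos : forall i : nat, (1 <= i)%N -> forall z : L,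
     gl L (i%:Z + 1) z <-> tensor_image lie (gl L 1) (gl L i%:Z) z)
  (L_neg : forall i : nat, (1 <= i)%N -> forall z : L,
     gl L (- i%:Z - 1) z <-> tensor_image lie (gl L (-1)) (gl L (- i%:Z)) z)
  (B_pieces : forall i : nat, is_nondegenerate
     (fun (x : submod_type (gl L i%:Z)) (y : submod_type (gl L (- i%:Z))) =>
        B (val x) (val y))) :
  exists std : is_standard (graded_pentad B_bilinear),
    lie_isomorphic L (pentad_lie std).
Proof.
have pos i z : gl L i%:Z z -> (forall w, gl L (- i%:Z) w -> B z w = 0) -> z = 0.
  move=> Gz Bz; apply: (congr1 val ((B_pieces i).1 (in_submod Gz) _)) => w.
  exact: Bz (submod_valP w).
have neg i z : gl L (- i%:Z) z -> (forall w, gl L i%:Z w -> B w z = 0) -> z = 0.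
  move=> Gz Bz; apply: (congr1 val ((B_pieces i).2 (in_submod Gz) _)) => w.
  exact: Bz (submod_valP w).
exists (graded_pentad_standard L0_neq0 B_bilinear B_invariant pos neg).
apply: graded_lie_isomorphic => // i z.
  (* Condition (1) is used at [i.+1], with degree i + 2 written as (i + 1) + 1, so its restriction
     to positive indices is met. *)
  by rewrite intS addrC => /L_pos; apply.
by rewrite intS addrC opprD => /L_neg; apply.
Qed.
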